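(* Let $(M,g)$ be a connected closed oriented Riemannian $4$-manifold. For any $h\in\Omega^0_+(\operatorname{Sym}^2(\Lambda^+))$, the endomorphism $F_{A(h)}^+h^{-1}$ of $\Lambda^+$ is self-adjoint.
   Context: Everything is smooth. $\Lambda^k=\bigwedge^kT^*M$; $\Omega^k(\mathcal{E})$ is the space of smooth $\mathcal{E}$-valued $k$-forms; $\star$ is the Hodge star of $g$, acting on the ordinary form factor of bundle-valued forms; $T^\pm=\frac12(T\pm\star T)$ for a bundle-valued $2$-form $T$. The bundle $\Lambda^+\subset\Lambda^2$ of self-dual $2$-forms ($\star\sigma=\sigma$) has rank three and carries the Euclidean metric induced by $g$ (for an orthonormal co-frame, the $\theta_a\wedge\theta_b$, $a<b$, are orthonormal in $\Lambda^2$). It is oriented by declaring positive the local orthonormal frame $\Sigma_i=-(\theta_0\wedge\theta_i+\theta_j\wedge\theta_k)/\sqrt2$, $(i,j,k)$ a cyclic permutation of $(1,2,3)$, where $(\theta_0,\theta_1,\theta_2,\theta_3)$ is a local oriented orthonormal co-frame. $[-,-]$ denotes the fibrewise cross product on $\Lambda^+$ ($[\Sigma_i,\Sigma_j]=\sum_k\epsilon_{ijk}\Sigma_k$), and $\mathfrak{so}(\Lambda^+)$ is identified with $\Lambda^+$ by letting $f$ correspond to $v\mapsto[f,v]$. For $\Lambda^+$-valued forms, $[\sum\alpha_i\otimes\Sigma_i,\sum\beta_j\otimes\Sigma_j]=\sum_{i,j}\alpha_i\wedge\beta_j\otimes[\Sigma_i,\Sigma_j]$. An $\operatorname{SO}(3)$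 connection $A$ on $\Lambda^+$ is a metric connection, with exterior covariant derivative $d_A$ and curvature $F_A\in\Omega^2(\Lambda^+)$ (via $\mathfrak{so}(\Lambda^+)\cong\Lambda^+$), so $d_A^2\alpha=[F_A,\alpha]$; for $a\in\Omega^1(\Lambda^+)$, $\nabla^{A+a}v=\nabla^Av+[a,v]$. A $\Lambda^+$-valued self-dual $2$-form $T=\sum_{i,j}T_{ji}\Sigma_j\otimes\Sigma_i$ (first factor: ordinary form; second: coefficient) is regarded as the endomorphism $v\mapsto\sum_{i,j}T_{ji}\langle\Sigma_i,v\rangle\Sigma_j$ of $\Lambda^+$; this applies to $F^+_{A(h)}$, and $F^+_{A(h)}h^{-1}$ is a composition of endomorphisms. $\operatorname{Sym}^2(\Lambda^+)$ is the bundle of self-adjoint endomorphisms of $\Lambda^+$, and $\Omega^0_+(\operatorname{Sym}^2(\Lambda^+))$ is the set of its smooth sections $h$ with $h>0$ (positive definite at every point). For an endomorphism field $h$ of $\Lambda^+$, $B_h\in\Omega^2(\Lambda^+)$ is given locally by $B_h=\sum_ih(\Sigma_i)\otimes\Sigma_i$ (first factor: ordinary $2$-form; second: coefficient), for any local oriented orthonormal frame. For $h\in\Omega^0_+(\operatorname{Sym}^2(\Lambda^+))$, $\operatorname{ad}_h\colon\Omega^1(\Lambda^+)\to\Omega^3(\Lambda^+)$, $\operatorname{ad}_h(a)=[a,B_h]$, is invertible, and $A(h):=\Gamma-\operatorname{ad}_h^{-1}(d_\Gamma B_h)$, where $\Gamma$ is the connection on $\Lambda^+$ induced by the Levi--Civita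 connection of $g$. *)

(* Defs.v *)
From HB Require Import structures.
From mathcomp Require Import all_boot all_order all_algebra.
From mathcomp Require Import all_classical all_reals all_analysis.

Set Implicit Arguments.
Unset Strict Implicit.
Unset Printing Implicit Defensive.

Import Order.TTheory GRing.Theory Num.Theory.
Import numFieldNormedType.Exports.

Local Open Scope classical_set_scope.
Local Open Scope ring_scope.

(* Tensors are handled through their components in the charts of an oriented
   atlas.  A covariant 2-tensor is the matrix of its values on the coordinate
   vector fields, so a 2-form is an antisymmetric matrix w, standing for
   \sum_(a < b) w a b dx^a /\ dx^b.  A form with values in Lambda^+ has
   matrices as components: its coefficients are themselves 2-forms. *)

Section PointwiseAlgebra.
Variable R : realType.
(* The matrix of the metric in the coordinate frame of the tangent space. *)
Variable G : 'M[R]_4.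
Implicit Types (w u v : 'M[R]_4) (f : 'M[R]_4 -> 'M[R]_4).

Definition levi_civita (a b c d : 'I_4) : R :=
  \det (\matrix_(i < 4, j < 4) (tnth [tuple a; b; c; d] i == j)%:R).

(* The factor 1/2 makes theta_a /\ theta_b, a < b, orthonormal. *)
Definition form_ip w v : R :=
  2^-1 * \sum_a \sum_b \sum_c \sum_d
    invmx G a c * invmx G b d * w a b * v c d.

Definition hodge w : 'M[R]_4 := \matrix_(c, d)
  (2^-1 * Num.sqrt (\det G) * \sum_a \sum_b \sum_e \sum_f
    invmx G a e * invmx G b f * w e f * levi_civita a b c d).

Definition self_dual w : Prop := w^T = - w /\ hodge w = w.

(* The rows of theta are the components of theta_0, ..., theta_3. *)
Definition oriented_coframe (theta : 'M[R]_4) : Prop :=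
  theta *m invmx G *m theta^T = 1%:M /\ 0 < \det theta.

Definition wedge (p q : 'rV[R]_4) : 'M[R]_4 := p^T *m q - q^T *m p.

Definition Sigma_of (theta : 'M[R]_4) (i : 'I_3) : 'M[R]_4 :=
  let t (k : 'I_3) := row (lift ord0 k) theta in
  - (Num.sqrt 2)^-1 *:
    (wedge (row ord0 theta) (t i) + wedge (t (ordS i)) (t (ordS (ordS i)))).

(* A frame is chosen at each point, with no regularity from point to point;
   the cross product and B_h do not depend on the choice. *)
Definition Sigma (i : 'I_3) : 'M[R]_4 := Sigma_of (get oriented_coframe) i.

Definition cross u v : 'M[R]_4 := \sum_(i < 3)
  (form_ip u (Sigma (ordS i)) * form_ip v (Sigma (ordS (ordS i)))
   - form_ip u (Sigma (ordS (ordS i))) * form_ip v (Sigma (ordS i)))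
  *: Sigma i.

(* Endomorphisms of Lambda^+ are functions on matrices, of which only the
   restriction to self-dual forms is meaningful. *)
Definition endomorphism f : Prop :=
  (forall u, self_dual u -> self_dual (f u)) /\
  (forall (k : R) u v, self_dual u -> self_dual v ->
     f (k *: u + v) = k *: f u + f v).

Definition self_adjoint f : Prop :=
  endomorphism f /\
  forall u v, self_dual u -> self_dual v -> form_ip (f u) v = form_ip u (f v).

Definition positive_definite f : Prop :=
  forall u, self_dual u -> u != 0 -> 0 < form_ip (f u) u.

Definition inverse f : 'M[R]_4 -> 'M[R]_4 :=
  fun u => get [set w | self_dual w /\ f w = u].

(* The components of \sum_i f(Sigma_i) (x) Sigma_i. *)
Definition Bform f (a b : 'I_4) : 'M[R]_4 :=
  \sum_(i < 3) f (Sigma i) a b *: Sigma i.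

Definition ad f (al : 'I_4 -> 'M[R]_4) (a b c : 'I_4) : 'M[R]_4 :=
  cross (al a) (Bform f b c) + cross (al b) (Bform f c a)
  + cross (al c) (Bform f a b).

Definition ad_inverse f (om : 'I_4 -> 'I_4 -> 'I_4 -> 'M[R]_4) :
    'I_4 -> 'M[R]_4 :=
  get [set al | (forall a, self_dual (al a)) /\
                forall a b c, ad f al a b c = om a b c].

(* The Hodge star acts on the form indices a, b and not on the coefficients. *)
Definition self_dual_part (T : 'I_4 -> 'I_4 -> 'M[R]_4) (a b : 'I_4) :
    'M[R]_4 :=
  2^-1 *: \matrix_(c, d)
    (T a b c d + hodge (\matrix_(a', b') T a' b' c d) a b).

(* For T = \sum T_ji Sigma_j (x) Sigma_i this is
   v |-> \sum T_ji <Sigma_i, v> Sigma_j. *)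
Definition endo_of (T : 'I_4 -> 'I_4 -> 'M[R]_4) : 'M[R]_4 -> 'M[R]_4 :=
  fun v => \matrix_(a, b) form_ip (T a b) v.

End PointwiseAlgebra.

Section LocalCalculus.
Variable R : realType.
Local Notation E := 'rV[R]_4.

Definition partial (c : 'I_4) (f : E -> R) : E -> R :=
  fun x => 'D_(delta_mx 0 c : E) f x.

(* C^oo: all iterated partial derivatives exist and are continuous. *)
Definition smooth_on (U : set E) (f : E -> R) : Prop :=
  forall (s : seq 'I_4) x, U x ->
    {for x, continuous (foldr partial f s)} /\
    forall c : 'I_4, derivable (foldr partial f s) x (delta_mx 0 c : E).

Definition smooth_mx_on (U : set E) (s : E -> 'M[R]_4) : Prop :=
  forall a b, smooth_on U (fun x => s x a b).

(* The metric in a chart. *)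
Variable g : E -> 'M[R]_4.

Definition smooth_section (V : set E) (s : E -> 'M[R]_4) : Prop :=
  smooth_mx_on V s /\ forall x, V x -> self_dual (g x) (s x).

(* Gamma^k_(ij) *)
Definition christoffel (k i j : 'I_4) (x : E) : R :=
  2^-1 * \sum_l invmx (g x) k l *
    (partial i (fun y => g y j l) x + partial j (fun y => g y i l) x
     - partial l (fun y => g y i j) x).

(* The Levi-Civita derivative of a 2-form along the c-th coordinate field;
   its restriction to self-dual forms is the connection Gamma. *)
Definition nablaLC (c : 'I_4) (s : E -> 'M[R]_4) (x : E) : 'M[R]_4 :=
  \matrix_(a, b) (partial c (fun y => s y a b) x
    - \sum_d christoffel d c a x * s x d b
    - \sum_d christoffel d c b x * s x a d).

(* The connection Gamma + al. *)
Definition nabla (al : E -> 'I_4 -> 'M[R]_4) (c : 'I_4) (s : E -> 'M[R]_4)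
    (x : E) : 'M[R]_4 :=
  nablaLC c s x + cross (g x) (al x c) (s x).

Definition d_LC (be : E -> 'I_4 -> 'I_4 -> 'M[R]_4) (x : E) (a b c : 'I_4) :
    'M[R]_4 :=
  nablaLC a (fun y => be y b c) x + nablaLC b (fun y => be y c a) x
  + nablaLC c (fun y => be y a b) x.

(* The curvature of Gamma + al is the Lambda^+-valued 2-form F such that
   d_A (d_A s) = [F, s] for every local section s of Lambda^+. *)
Definition curvature (al : E -> 'I_4 -> 'M[R]_4) (x : E) (a b : 'I_4) :
    'M[R]_4 :=
  get [set F | self_dual (g x) F /\
    forall (V : set E) (s : E -> 'M[R]_4),
      open V -> V x -> smooth_section V s ->
      nabla al a (nabla al b s) x - nabla al b (nabla al a s) x
      = cross (g x) F (s x)].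

(* The connection form of A(h) relative to Gamma. *)
Definition A_of (h : E -> 'M[R]_4 -> 'M[R]_4) (x : E) (c : 'I_4) : 'M[R]_4 :=
  - ad_inverse (g x) (h x) (d_LC (fun y => Bform (g y) (h y)) x) c.

Definition Fplus_endo (h : E -> 'M[R]_4 -> 'M[R]_4) (x : E) :
    'M[R]_4 -> 'M[R]_4 :=
  endo_of (g x) (self_dual_part (g x) (curvature (A_of h) x)).

End LocalCalculus.

Section Manifold.
Variables (R : realType) (M : topologicalType).
Local Notation E := 'rV[R]_4.

Definition jacobian (f : E -> E) (x : E) : 'M[R]_4 :=
  \matrix_(a, b) partial a (fun y => f y 0 b) x.

Record oriented_atlas := OrientedAtlas {
  chart : Type;
  dom : chart -> set M;
  coord : chart -> M -> E;
  param : chart -> E -> M;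
  cod := fun i => coord i @` dom i;
  overlap := fun i j => coord i @` (dom i `&` dom j);
  transition := fun i j => coord j \o param i;
  dom_open : forall i, open (dom i);
  dom_cover : forall p, exists i, dom i p;
  cod_open : forall i, open (cod i);
  coordK : forall i p, dom i p -> param i (coord i p) = p;
  coord_continuous : forall i p, dom i p -> {for p, continuous (coord i)};
  param_continuous : forall i x, cod i x -> {for x, continuous (param i)};
  transition_smooth : forall i j (b : 'I_4),
    smooth_on (overlap i j) (fun x => transition i j x 0 b);
  transition_oriented : forall i j x, overlap i j x ->
    0 < \det (jacobian (transition i j) x)
}.

Variable X : oriented_atlas.

(* Change of components of a covariant 2-tensor, from chart j to chart i. *)
Definition pull (i j : chart X) (x : E) (w : 'M[R]_4) : 'M[R]_4 :=
  let J := jacobian (transition i j) x in J *m w *m J^T.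

Definition riemannian_metric (g : chart X -> E -> 'M[R]_4) : Prop :=
  [/\ forall i, smooth_mx_on (cod i) (g i),
      forall i x, cod i x -> (g i x)^T = g i x,
      forall i x (v : E), cod i x -> v != 0 -> 0 < (v *m g i x *m v^T) 0 0 &
      forall i j x, overlap i j x -> g i x = pull i j x (g j (transition i j x))].

Definition positive_sym_section (g : chart X -> E -> 'M[R]_4)
    (h : chart X -> E -> 'M[R]_4 -> 'M[R]_4) : Prop :=
  [/\ forall i x, cod i x -> self_adjoint (g i x) (h i x),
      forall i x, cod i x -> positive_definite (g i x) (h i x),
      forall i (V : set E) (s : E -> 'M[R]_4), open V -> V `<=` cod i ->
        smooth_section (g i) V s ->
        smooth_section (g i) V (fun x => h i x (s x)) &
      forall i j x w, overlap i j x -> self_dual (g j (transition i j x)) w ->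
        h i x (pull i j x w) = pull i j x (h j (transition i j x) w)].

End Manifold.

(* Main.v *)
Require Import Defs.
From HB Require Import structures.
From mathcomp Require Import all_boot all_order all_algebra.
From mathcomp Require Import all_classical all_reals all_analysis.
From mathcomp Require Import perm ring lra.

(** The statement is local, so everything happens in one chart.  Write [B_h]
    for the form [Bform], [A = Gamma + a] for the connection [A(h)] and [F] for
    its curvature.  Since [d_A B_h = d_Gamma B_h + [a, B_h]] and
    [a = - ad_h^-1 (d_Gamma B_h)], the connection is made so that
    [d_A B_h = 0].  Applying [d_A] once more gives [[F, B_h] = 0].  Put
    [F = \sum_i F_i (x) Sigma_i]; as the forms [h(Sigma_j)] are self-dual, the
    wedge product [F_i /\ h(Sigma_j)] only sees the self-dual part of [F_i] and
    is [<F_i^+, h(Sigma_j)>] times the volume form.  The component of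
    [[F, B_h] = 0] along [Sigma_k] therefore says that the matrix
    [<F_i^+, h(Sigma_j)>] is symmetric.  If [T] is the matrix of [F^+], this
    matrix is [T^T h]; so [T^T h = h T], which is the symmetry of [T h^-1].

    To turn this into a proof one works in a smooth oriented orthonormal
    coframe, obtained by [smooth_cholesky].  The frame [Sigma_i] it induces
    identifies sections of Lambda^+ with functions to R^3.  The bracket becomes
    the cross product ([cross_frame]), the Levi-Civita derivative becomes
    [d + omega x] ([nablaLC_frame]), and [A] becomes [d + (omega + a) x]
    ([nabla_frame]).  Being chosen by description, [a] and [F] have to be
    computed before anything can be said about them.  For [a] this is
    [ad_solutionP], an explicit inverse of [ad_h] that rests on the quaternion
    identity [sd_form_triple]; it shows at the same time that [a] is smooth.
    For [F] it is [curvature_frame], which needs the symmetry of second partial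
    derivatives ([partialC]) through [cov_deriv_commutator].  The identity
    [[F, B_h] = 0] is [curvature_wedge_B], and [self_adjoint_wedge] is the
    linear algebra that concludes. *)

Set Implicit Arguments.
Unset Strict Implicit.
Unset Printing Implicit Defensive.

Import Order.TTheory GRing.Theory Num.Theory.
Import numFieldNormedType.Exports.

Local Open Scope classical_set_scope.
Local Open Scope ring_scope.

(** * Closure properties of smooth functions *)

Section SmoothCalculus.
Variable R : realType.
Local Notation E := 'rV[R]_4.
Implicit Types (U : set E) (f g : E -> R) (c : 'I_4).

Lemma eq_on_near U f g x : open U -> U x -> {in U, f =1 g} ->
  \near x, f x = g x.
Proof.
move=> oU Ux fg; near=> y; apply: fg; rewrite inE; near: y.
exact: open_nbhs_nbhs.
Unshelve. all: by end_near. Qed.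

Lemma eq_on_partial U f g c x : open U -> U x -> {in U, f =1 g} ->
  partial c f x = partial c g x.
Proof. by move=> oU Ux fg; apply: near_eq_derive; apply: eq_on_near fg. Qed.

(** The expressions that occur below, generated from smooth functions.  The
    point of a syntactic class is that it is stable under [partial], by the
    rules of differentiation, so that one round of differentiation settles all
    orders at once. *)
Inductive smooth_gen U : (E -> R) -> Prop :=
| SmoothBase f of smooth_on U f : smooth_gen U f
| SmoothCst k : smooth_gen U (fun=> k)
| SmoothAdd f g of smooth_gen U f & smooth_gen U g :
    smooth_gen U (fun x => f x + g x)
| SmoothMul f g of smooth_gen U f & smooth_gen U g :
    smooth_gen U (fun x => f x * g x)
| SmoothInv f of smooth_gen U f & (forall x, U x -> f x != 0) :
    smooth_gen U (fun x => (f x)^-1)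
| SmoothSqrt f of smooth_gen U f & (forall x, U x -> 0 < f x) :
    smooth_gen U (fun x => Num.sqrt (f x))
| SmoothEq f g of smooth_gen U f & {in U, f =1 g} : smooth_gen U g.

Lemma smooth_on_partial U f c : smooth_on U f -> smooth_on U (partial c f).
Proof. by move=> sf s x Ux; have := sf (rcons s c) x Ux; rewrite foldr_rcons. Qed.

Lemma smooth_on_sub (U V : set E) f : V `<=` U -> smooth_on U f -> smooth_on V f.
Proof. by move=> VU sf s x Vx; exact: sf s x (VU x Vx). Qed.

Lemma smooth_on_continuous U f x : smooth_on U f -> U x ->
  {for x, continuous f}.
Proof. by move=> sf Ux; have [] := sf [::] x Ux. Qed.

Lemma smooth_on_derivable U f c x : smooth_on U f -> U x ->
  derivable f x (delta_mx 0 c : E).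
Proof. by move=> sf Ux; have [_] := sf [::] x Ux; apply. Qed.

Lemma is_derive_sqrt_comp f (x v : E) : 0 < f x -> derivable f x v ->
  is_derive x v (fun y => Num.sqrt (f y)) ('D_v f x * (2 * Num.sqrt (f x))^-1).
Proof.
move=> fx0 df.
set k := fun t : R => f (t *: v + x).
have k0 : k 0 = f x by rewrite /k scale0r add0r.
have dk : derivable k 0 1 by exact: (proj1 (derivable1P f x v)) df.
have Dk : 'D_1 k 0 = 'D_v f x.
  rewrite /derive; set g1 := fun h => h^-1 *: _; set g2 := fun h => h^-1 *: _.
  suff -> : g1 = g2 by [].
  by rewrite funeqE /g1 /g2 => t /=; rewrite k0 addr0 /k [_%:A]mulr1.
have ds : is_derive (k 0) 1 (@Num.sqrt R) (2 * Num.sqrt (f x))^-1.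
  by rewrite k0; apply: is_derive1_sqrt.
have dsk : is_derive (0 : R) (1 : R) (@Num.sqrt R \o k) ('D_v f x * (2 * Num.sqrt (f x))^-1).
  have dk' : is_derive (0 : R) (1 : R) k ('D_v f x) by rewrite -Dk; apply: derivableP.
  by have := @is_derive1_comp R (@Num.sqrt R) k 0 _ _ ds dk'; rewrite mulrC.
have deq : 'D_v (fun y => Num.sqrt (f y)) x = 'D_(1 : R) (@Num.sqrt R \o k) (0 : R).
  rewrite /derive; set g1 := fun h => h^-1 *: _; set g2 := fun h => h^-1 *: _.
  suff -> : g1 = g2 by [].
  by rewrite funeqE /g1 /g2 => t /=; rewrite k0 addr0 /k [_%:A]mulr1.
split; last by rewrite deq derive_val.
by apply: (proj2 (derivable1P _ _ _)); exact: (@ex_derive _ _ _ _ _ _ _ dsk).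
Qed.

(** One differentiation: a generated function is continuous, has partial
    derivatives, and these are generated again.  The factors [(f x)^-1] and
    [Num.sqrt (f x)] reappear in their own derivatives, which is why the class
    is closed. *)
Lemma smooth_gen_step U f : open U -> smooth_gen U f ->
  (forall x, U x -> {for x, continuous f} /\
     forall c, derivable f x (delta_mx 0 c : E)) /\
  (forall c, smooth_gen U (partial c f)).
Proof.
move=> oU; elim=> {f}.
- move=> f sf; split=> [x Ux|c]; first exact: (sf [::]).
  by apply: SmoothBase; exact: smooth_on_partial.
- move=> k; split=> [x _|c].
    by split=> [|c]; [exact: cst_continuous | exact: derivable_cst].
  apply: (SmoothEq (SmoothCst _ 0)) => x _.
  by rewrite /partial derive_cst.
- move=> f g _ [cf df] _ [cg dg]; split=> [x Ux|c].
    have [cfx dfx] := cf x Ux; have [cgx dgx] := cg x Ux.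
    split=> [|c]; first exact: continuousD.
    exact: derivableD.
  apply: (SmoothEq (SmoothAdd (df c) (dg c))) => x; rewrite inE => Ux.
  have [_ dfx] := cf x Ux; have [_ dgx] := cg x Ux.
  by rewrite /partial [RHS]deriveD.
- move=> f g gf [cf df] gg [cg dg]; split=> [x Ux|c].
    have [cfx dfx] := cf x Ux; have [cgx dgx] := cg x Ux.
    split=> [|c]; first exact: continuousM.
    exact: derivableM.
  apply: (SmoothEq (SmoothAdd (SmoothMul gf (dg c)) (SmoothMul gg (df c)))) => x.
  rewrite inE => Ux; have [_ dfx] := cf x Ux; have [_ dgx] := cg x Ux.
  by rewrite /partial [RHS]deriveM.
- move=> f gf [cf df] fn0; split=> [x Ux|c].
    have [cfx dfx] := cf x Ux.
    split=> [|c]; first by apply: continuousV => //; exact: fn0.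
    by apply: derivableV; first exact: fn0.
  apply: (SmoothEq (SmoothMul (SmoothCst _ (-1)) (SmoothMul
    (SmoothMul (SmoothInv gf fn0) (SmoothInv gf fn0)) (df c)))) => x.
  rewrite inE => Ux; have [_ dfx] := cf x Ux.
  rewrite /partial [RHS]deriveV//; last exact: fn0.
  by rewrite /GRing.scale/= mulN1r mulNr expr2 invfM.
- move=> f gf [cf df] f0; split=> [x Ux|c].
    have [cfx dfx] := cf x Ux.
    split=> [|c].
      by apply: (continuous_comp cfx); exact: sqrt_continuous.
    by have [] := is_derive_sqrt_comp (f0 x Ux) (dfx c).
  have s0 x : U x -> Num.sqrt (f x) != 0.
    by move=> Ux; rewrite gt_eqF// sqrtr_gt0 f0.
  apply: (SmoothEq (SmoothMul (df c) (SmoothMul (SmoothCst _ 2^-1)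
    (SmoothInv (SmoothSqrt gf f0) s0)))) => x.
  rewrite inE => Ux; have [_ dfx] := cf x Ux.
  have [_] := is_derive_sqrt_comp (f0 x Ux) (dfx c).
  by rewrite /partial => ->; rewrite invfM.
- move=> f g gf [cf df] fg; split=> [x Ux|c].
    have [cfx dfx] := cf x Ux; have fgx := eq_on_near oU Ux fg.
    split=> [|c]; last exact: near_eq_derivable (fgx) (dfx c).
    have fgxE : f x = g x by apply: fg; rewrite inE.
    rewrite /prop_for /continuous_at -fgxE.
    exact: cvg_trans (near_eq_cvg fgx) cfx.
  apply: (SmoothEq (df c)) => x; rewrite inE => Ux.
  exact: eq_on_partial fg.
Qed.

Lemma smooth_gen_on U f : open U -> smooth_gen U f -> smooth_on U f.
Proof.
move=> oU gf s x Ux.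
have gfs : smooth_gen U (foldr (@partial R) f s).
  by elim: s => //= c s IH; have [_] := smooth_gen_step oU IH; apply.
by have [h _] := smooth_gen_step oU gfs; have [] := h x Ux.
Qed.

Section Closure.
Variable U : set E.
Hypothesis oU : open U.

Lemma smooth_cst k : smooth_on U (fun=> k).
Proof. exact/smooth_gen_on/SmoothCst. Qed.

Lemma smoothD f g : smooth_on U f -> smooth_on U g ->
  smooth_on U (fun x => f x + g x).
Proof. by move=> sf sg; apply/smooth_gen_on/SmoothAdd => //; apply: SmoothBase. Qed.

Lemma smoothM f g : smooth_on U f -> smooth_on U g ->
  smooth_on U (fun x => f x * g x).
Proof. by move=> sf sg; apply/smooth_gen_on/SmoothMul => //; apply: SmoothBase. Qed.

Lemma smoothN f : smooth_on U f -> smooth_on U (fun x => - f x).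
Proof.
move=> sf; under eq_fun do rewrite -mulN1r.
exact: smoothM (smooth_cst _) sf.
Qed.

Lemma smoothB f g : smooth_on U f -> smooth_on U g ->
  smooth_on U (fun x => f x - g x).
Proof. by move=> sf sg; exact: smoothD sf (smoothN sg). Qed.

Lemma smoothV f : smooth_on U f -> (forall x, U x -> f x != 0) ->
  smooth_on U (fun x => (f x)^-1).
Proof. by move=> sf f0; apply/smooth_gen_on/SmoothInv => //; apply: SmoothBase. Qed.

Lemma smooth_sqrt f : smooth_on U f -> (forall x, U x -> 0 < f x) ->
  smooth_on U (fun x => Num.sqrt (f x)).
Proof. by move=> sf f0; apply/smooth_gen_on/SmoothSqrt => //; apply: SmoothBase. Qed.

Lemma smooth_eq f g : smooth_on U f -> {in U, f =1 g} -> smooth_on U g.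
Proof. by move=> sf fg; apply/smooth_gen_on/(SmoothEq _ fg) => //; apply: SmoothBase. Qed.

Lemma smooth_sum (I : Type) (r : seq I) (P : pred I) (F : I -> E -> R) :
  (forall i, P i -> smooth_on U (F i)) ->
  smooth_on U (fun x => \sum_(i <- r | P i) F i x).
Proof.
move=> sF; elim: r => [|i r IH].
  by apply: (smooth_eq (smooth_cst 0)) => x _; rewrite /= big_nil.
have -> : (fun x => \sum_(j <- i :: r | P j) F j x) = fun x =>
    if P i then F i x + \sum_(j <- r | P j) F j x else \sum_(j <- r | P j) F j x.
  by rewrite funeqE => x; rewrite big_cons.
by case Pi: (P i); [exact: smoothD (sF i Pi) IH | exact: IH].
Qed.

Lemma smooth_prod (I : Type) (r : seq I) (P : pred I) (F : I -> E -> R) :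
  (forall i, P i -> smooth_on U (F i)) ->
  smooth_on U (fun x => \prod_(i <- r | P i) F i x).
Proof.
move=> sF; elim: r => [|i r IH].
  by apply: (smooth_eq (smooth_cst 1)) => x _; rewrite /= big_nil.
have -> : (fun x => \prod_(j <- i :: r | P j) F j x) = fun x =>
    if P i then F i x * \prod_(j <- r | P j) F j x else \prod_(j <- r | P j) F j x.
  by rewrite funeqE => x; rewrite big_cons.
by case Pi: (P i); [exact: smoothM (sF i Pi) IH | exact: IH].
Qed.

End Closure.
End SmoothCalculus.

(** * Symmetry of second partial derivatives *)

Section Schwarz.
Variable R : realType.
Local Notation E := 'rV[R]_4.
Implicit Types (U : set E) (f g : E -> R) (c : 'I_4).

Lemma is_derive_line f (x u : E) (s : R) : derivable f (x + s *: u) u ->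
  is_derive (s : R) (1 : R) (fun t => f (x + t *: u)) ('D_u f (x + s *: u)).
Proof.
move=> df.
have eqq : (fun h : R => h^-1 *: (((fun t => f (x + t *: u)) \o shift s) (h *: 1)
     - f (x + s *: u))) =
   (fun h : R => h^-1 *: ((f \o shift (x + s *: u)) (h *: u) - f (x + s *: u))).
  rewrite funeqE => h /=; rewrite [_%:A]mulr1 scalerDl.
  by rewrite addrCA.
by split; rewrite /derivable /derive eqq.
Qed.

(** The mean value theorem twice: the second difference over a square of
    side [h] is [h ^+ 2] times a mixed derivative at some point of the square.
    The left-hand side is symmetric in [u] and [v]. *)
Lemma second_difference f (x u v : E) (h : R) : 0 < h ->
  (forall s t, s \in `[0, h] -> t \in `[0, h] ->
     derivable f (x + s *: u + t *: v) u /\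
     derivable (fun y => 'D_u f y) (x + s *: u + t *: v) v) ->
  exists s t, [/\ s \in `[0, h], t \in `[0, h] &
    f (x + h *: u + h *: v) - f (x + h *: u) - f (x + h *: v) + f x
    = 'D_v (fun y => 'D_u f y) (x + s *: u + t *: v) * h * h].
Proof.
move=> h0 H.
have i0 : (0 : R) \in `[0, h] by rewrite in_itv/= lexx ltW.
have ih : h \in `[0, h] by rewrite in_itv/= lexx ltW.
pose phi s := f ((x + h *: v) + s *: u) - f (x + s *: u).
have dphi s : s \in `[0, h] -> is_derive (s : R) (1 : R) phi
    ('D_u f ((x + h *: v) + s *: u) - 'D_u f (x + s *: u)).
  move=> si; apply: is_deriveB; apply: is_derive_line.
    by rewrite addrAC; exact: (proj1 (H s h si ih)).
  by have := proj1 (H s 0 si i0); rewrite scale0r addr0.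
have cphi : {within `[0, h], continuous phi}.
  by apply: derivable_within_continuous => s /dphi [].
have [s si phiE] := @MVT_segment R phi _ 0 h (ltW h0)
  (fun s si => dphi s (subset_itv_oo_cc si)) cphi.
pose psi t := 'D_u f ((x + s *: u) + t *: v).
have dpsi t : t \in `[0, h] -> is_derive (t : R) (1 : R) psi
    ('D_v (fun y => 'D_u f y) ((x + s *: u) + t *: v)).
  move=> ti; apply: (@is_derive_line (fun y => 'D_u f y)).
  exact: (proj2 (H s t si ti)).
have cpsi : {within `[0, h], continuous psi}.
  by apply: derivable_within_continuous => t /dpsi [].
have [t ti psiE] := @MVT_segment R psi _ 0 h (ltW h0)
  (fun t ti => dpsi t (subset_itv_oo_cc ti)) cpsi.
exists s, t; split=> //.
move: phiE psiE; rewrite /phi /psi !subr0 !scale0r !addr0 => phiE psiE.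
rewrite -psiE [x + s *: u + h *: v]addrAC -phiE [x + h *: v + h *: u]addrAC.
by rewrite opprB addrA -[LHS]addrA [- _ + f x]addrC addrA.
Qed.

(** Both mixed derivatives are, at points arbitrarily close to [x], the same
    quotient of a second difference; by continuity they agree at [x]. *)
Lemma partialC U f a b x : open U -> U x -> smooth_on U f ->
  partial a (partial b f) x = partial b (partial a f) x.
Proof.
move=> oU Ux sf.
pose u : E := delta_mx 0 a; pose v : E := delta_mx 0 b.
apply/eqP; rewrite -subr_eq0 -normr_le0; apply/ler_addgt0Pl => e e0.
rewrite addr0.
have e2 : 0 < e / 2 by rewrite divr_gt0.
have cab := smooth_on_continuous
  (smooth_on_partial a (smooth_on_partial b sf)) Ux.
have cba := smooth_on_continuous
  (smooth_on_partial b (smooth_on_partial a sf)) Ux.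
have nU : \forall y \near x, U y by exact: open_nbhs_nbhs.
have /cvgrPdist_lt /(_ _ e2) nab := cab.
have /cvgrPdist_lt /(_ _ e2) nba := cba.
have FF : Filter (nbhs x) by exact: nbhs_filter.
have {nU nab nba} nab := @filterI _ _ FF _ _ nU (@filterI _ _ FF _ _ nab nba).
have [r /= r0 Hr] := proj1 (nbhs_ballP x _) nab.
pose k := `|u| + `|v| + 1.
have k0 : 0 < k by rewrite ltr_pwDr// addr_ge0.
(* [h] makes the square with corner [x] and side [h] lie in the ball. *)
pose h := r / k / 2.
have h0 : 0 < h by rewrite !divr_gt0.
have inball s t : s \in `[0, h] -> t \in `[0, h] -> ball x r (x + s *: u + t *: v).
  rewrite !in_itv/= => /andP[s0 sh] /andP[t0 th].
  rewrite -ball_normE /ball_/= -addrA opprD addNKr normrN.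
  rewrite (le_lt_trans (ler_normD _ _))// !normrZ !ger0_norm//.
  apply: (@le_lt_trans _ _ (h * k)).
    rewrite /k !mulrDr mulr1 -[leLHS]addr0 lerD// ?(ltW h0)//.
    by rewrite lerD// ler_wpM2r.
  by rewrite /h mulrAC divfK ?gt_eqF// ltr_pdivrMr// ltr_pMr// ltr1n.
have Uin s t : s \in `[0, h] -> t \in `[0, h] -> U (x + s *: u + t *: v).
  move=> si ti; exact: (proj1 (Hr _ (inball s t si ti))).
have [s [t [si ti E1]]] := @second_difference f x u v h h0 (fun s t si ti =>
  conj (@smooth_on_derivable R U _ a _ sf (Uin s t si ti))
       (@smooth_on_derivable R U _ b _ (@smooth_on_partial R U f a sf) (Uin s t si ti))).
have Uin' s' t' : s' \in `[0, h] -> t' \in `[0, h] -> U (x + s' *: v + t' *: u).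
  by move=> si' ti'; rewrite addrAC; exact: Uin.
have [s' [t' [si' ti' E2]]] := @second_difference f x v u h h0 (fun s t si ti =>
  conj (@smooth_on_derivable R U _ b _ sf (Uin' s t si ti))
       (@smooth_on_derivable R U _ a _ (@smooth_on_partial R U f b sf) (Uin' s t si ti))).
have [_ [_ B1]] := Hr _ (inball s t si ti).
have [_ [B2 _]] := Hr _ (inball t' s' ti' si').
rewrite addrAC in B2.
have E12 : partial b (partial a f) (x + s *: u + t *: v) =
           partial a (partial b f) (x + s' *: v + t' *: u).
  apply: (mulIf (lt0r_neq0 h0)); apply: (mulIf (lt0r_neq0 h0)).
  rewrite -[LHS]E1 -[RHS]E2 [x + h *: v + h *: u]addrAC.
  by rewrite [X in X + _]addrAC.
rewrite E12 in B1.
set p := partial a _ x in B2 *; set q := partial b _ x in B1 *.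
set w := partial a _ _ in B1 B2.
clearbody p q w.
apply: ltW; rewrite -(subrK w p) -addrA (splitr e).
rewrite distrC in B1.
exact: (le_lt_trans (ler_normD _ _) (ltrD B2 B1)).
Qed.

End Schwarz.

(** * Differential calculus of matrix-valued functions *)

Opaque smooth_on.

Section MatrixCalculus.
Variable R : realType.
Local Notation E := 'rV[R]_4.
Variable U : set E.
Hypothesis oU : open U.

Section Partial.
Variables (f g : E -> R) (c : 'I_4) (x : E).
Hypothesis Ux : U x.
Hypotheses (sf : smooth_on U f) (sg : smooth_on U g).

Let df := @smooth_on_derivable R U f c x sf Ux.
Let dg := @smooth_on_derivable R U g c x sg Ux.

Lemma partialD :
  partial c (fun y => f y + g y) x = partial c f x + partial c g x.
Proof. exact: (deriveD df dg). Qed.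

Lemma partialB :
  partial c (fun y => f y - g y) x = partial c f x - partial c g x.
Proof. exact: (deriveB df dg). Qed.

Lemma partialM :
  partial c (fun y => f y * g y) x = partial c f x * g x + f x * partial c g x.
Proof.
rewrite [RHS]addrC [partial c f x * _]mulrC.
exact: (deriveM df dg).
Qed.

End Partial.

Lemma partial_cst c (k : R) (x : E) : partial c (fun=> k) x = 0.
Proof. exact: derive_cst. Qed.

Lemma partial_sum (I : Type) (r : seq I) (F : I -> E -> R) c x : U x ->
  (forall i, smooth_on U (F i)) ->
  partial c (fun y => \sum_(i <- r) F i y) x = \sum_(i <- r) partial c (F i) x.
Proof.
move=> Ux sF; elim: r => [|i r IH].
  rewrite big_nil -[RHS](partial_cst c 0 x); congr (partial c _ x).
  by rewrite funeqE => y; rewrite big_nil.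
have -> : (fun y => \sum_(j <- i :: r) F j y) =
  (fun y => F i y + \sum_(j <- r) F j y).
  by rewrite funeqE => y; rewrite big_cons.
rewrite big_cons -IH; apply: (partialD c Ux (sF i)).
exact: (smooth_sum oU r (fun i _ => sF i)).
Qed.

Definition smooth_mx m n (V : set E) (A : E -> 'M[R]_(m, n)) : Prop :=
  forall i j, smooth_on V (fun y => A y i j).

Definition partial_mx m n c (A : E -> 'M[R]_(m, n)) (x : E) : 'M[R]_(m, n) :=
  \matrix_(i, j) partial c (fun y => A y i j) x.

Lemma smooth_mx_eq m n (A B : E -> 'M[R]_(m, n)) :
  smooth_mx U A -> {in U, A =1 B} -> smooth_mx U B.
Proof.
move=> sA AB i j; apply: (smooth_eq oU (sA i j)) => y Uy.
by rewrite /= AB.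
Qed.

Lemma smooth_mx_cst m n (A : 'M[R]_(m, n)) : smooth_mx U (fun=> A).
Proof. by move=> i j; exact: (smooth_cst oU). Qed.

Lemma smooth_mxD m n (A B : E -> 'M[R]_(m, n)) :
  smooth_mx U A -> smooth_mx U B -> smooth_mx U (fun y => A y + B y).
Proof.
move=> sA sB i j; apply: (smooth_eq oU (smoothD oU (sA i j) (sB i j))) => y _.
by rewrite mxE.
Qed.

Lemma smooth_mxN m n (A : E -> 'M[R]_(m, n)) :
  smooth_mx U A -> smooth_mx U (fun y => - A y).
Proof.
move=> sA i j; apply: (smooth_eq oU (smoothN oU (sA i j))) => y _.
by rewrite mxE.
Qed.

Lemma smooth_mxB m n (A B : E -> 'M[R]_(m, n)) :
  smooth_mx U A -> smooth_mx U B -> smooth_mx U (fun y => A y - B y).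
Proof. by move=> sA sB; exact: smooth_mxD sA (smooth_mxN sB). Qed.

Lemma smooth_mxT m n (A : E -> 'M[R]_(m, n)) :
  smooth_mx U A -> smooth_mx U (fun y => (A y)^T).
Proof.
move=> sA i j; apply: (smooth_eq oU (sA j i)) => y _.
by rewrite /= mxE.
Qed.

Lemma smooth_mxZ m n (f : E -> R) (A : E -> 'M[R]_(m, n)) :
  smooth_on U f -> smooth_mx U A -> smooth_mx U (fun y => f y *: A y).
Proof.
move=> sf sA i j; apply: (smooth_eq oU (smoothM oU sf (sA i j))) => y _.
by rewrite mxE.
Qed.

Lemma smooth_mxM m n p (A : E -> 'M[R]_(m, n)) (B : E -> 'M[R]_(n, p)) :
  smooth_mx U A -> smooth_mx U B -> smooth_mx U (fun y => A y *m B y).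
Proof.
move=> sA sB i j; apply: (smooth_eq oU (f := fun y => \sum_k A y i k * B y k j)).
  by apply: (smooth_sum oU) => k _; exact: (smoothM oU (sA i k) (sB k j)).
by move=> y _; rewrite mxE.
Qed.

Lemma smooth_mx_sum m n (I : Type) (r : seq I) (F : I -> E -> 'M[R]_(m, n)) :
  (forall i, smooth_mx U (F i)) ->
  smooth_mx U (fun x => \sum_(i <- r) F i x).
Proof.
move=> sF i j; apply: (smooth_eq oU (f := fun y => \sum_(k <- r) F k y i j)).
  by apply: (smooth_sum oU) => k _; exact: sF.
by move=> y _; rewrite summxE.
Qed.

Lemma smooth_block_mx m1 m2 n1 n2 (A : E -> 'M[R]_(m1, n1))
    (B : E -> 'M[R]_(m1, n2)) (C : E -> 'M[R]_(m2, n1))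
    (D : E -> 'M[R]_(m2, n2)) :
  smooth_mx U A -> smooth_mx U B -> smooth_mx U C -> smooth_mx U D ->
  smooth_mx U (fun y => block_mx (A y) (B y) (C y) (D y)).
Proof.
move=> sA sB sC sD i j.
case: (split_ordP i) => i' ->; case: (split_ordP j) => j' ->.
- by apply: (smooth_eq oU (sA i' j')) => y _; rewrite /= block_mxEul.
- by apply: (smooth_eq oU (sB i' j')) => y _; rewrite /= block_mxEur.
- by apply: (smooth_eq oU (sC i' j')) => y _; rewrite /= block_mxEdl.
- by apply: (smooth_eq oU (sD i' j')) => y _; rewrite /= block_mxEdr.
Qed.

Lemma smooth_det n (A : E -> 'M[R]_n) :
  smooth_mx U A -> smooth_on U (fun y => \det (A y)).
Proof.
move=> sA; apply: (smooth_sum oU) => s _; apply: (smoothM oU).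
  exact: (smooth_cst oU).
by apply: (smooth_prod oU) => i _; exact: sA.
Qed.

Lemma smooth_adj n (A : E -> 'M[R]_n) :
  smooth_mx U A -> smooth_mx U (fun y => \adj (A y)).
Proof.
move=> sA i j.
apply: (smooth_eq oU (f := fun y => (-1) ^+ (j + i) * \det (row' j (col' i (A y))))).
  apply: (smoothM oU); first exact: (smooth_cst oU).
  apply: smooth_det => k l; apply: (smooth_eq oU (sA (lift j k) (lift i l))) => y _.
  by rewrite !mxE.
by move=> y _; rewrite mxE.
Qed.

Lemma smooth_invmx n (A : E -> 'M[R]_n) :
  smooth_mx U A -> (forall y, U y -> A y \in unitmx) ->
  smooth_mx U (fun y => invmx (A y)).
Proof.
move=> sA uA; apply: (smooth_mx_eq (A := fun y => (\det (A y))^-1 *: \adj (A y))).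
  apply: smooth_mxZ; last exact: smooth_adj.
  apply: (smoothV oU); first exact: smooth_det.
  by move=> y /uA; rewrite unitmxE unitfE.
by move=> y; rewrite inE => /uA uAy; rewrite /invmx uAy.
Qed.

Lemma smooth_partial_mx m n c (A : E -> 'M[R]_(m, n)) :
  smooth_mx U A -> smooth_mx U (partial_mx c A).
Proof.
move=> sA i j; apply: (smooth_eq oU (smooth_on_partial c (sA i j))) => y _.
by rewrite mxE.
Qed.

Lemma partial_mx_eq m n c (A B : E -> 'M[R]_(m, n)) x :
  U x -> {in U, A =1 B} -> partial_mx c A x = partial_mx c B x.
Proof.
move=> Ux AB; apply/matrixP => i j; rewrite !mxE; apply: (eq_on_partial _ oU Ux).
by move=> y Uy; rewrite AB.
Qed.

Section Dmx.
Variables (c : 'I_4) (x : E).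
Hypothesis Ux : U x.

Lemma partial_mx_cst m n (A : 'M[R]_(m, n)) : partial_mx c (fun=> A) x = 0.
Proof. by apply/matrixP => i j; rewrite !mxE partial_cst. Qed.

Lemma partial_mxD m n (A B : E -> 'M[R]_(m, n)) : smooth_mx U A -> smooth_mx U B ->
  partial_mx c (fun y => A y + B y) x = partial_mx c A x + partial_mx c B x.
Proof.
move=> sA sB; apply/matrixP => i j; rewrite !mxE.
rewrite -(partialD c Ux (sA i j) (sB i j)); congr (partial c _ x).
by rewrite funeqE => y; rewrite mxE.
Qed.

Lemma partial_mxT m n (A : E -> 'M[R]_(m, n)) :
  partial_mx c (fun y => (A y)^T) x = (partial_mx c A x)^T.
Proof.
apply/matrixP => i j; rewrite !mxE; congr (partial c _ x).
by rewrite funeqE => y; rewrite mxE.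
Qed.

Lemma partial_mxM m n p (A : E -> 'M[R]_(m, n)) (B : E -> 'M[R]_(n, p)) :
  smooth_mx U A -> smooth_mx U B ->
  partial_mx c (fun y => A y *m B y) x = partial_mx c A x *m B x + A x *m partial_mx c B x.
Proof.
move=> sA sB; apply/matrixP => i j; rewrite !mxE -big_split/=.
have -> : (fun y => (A y *m B y) i j) = fun y => \sum_k A y i k * B y k j.
  by rewrite funeqE => y; rewrite mxE.
rewrite partial_sum; [|exact: Ux|by move=> k; exact: (smoothM oU (sA i k) (sB k j))].
apply: eq_bigr => k _; rewrite !mxE.
exact: (partialM c Ux (sA i k) (sB k j)).
Qed.

Lemma partial_mxZl m n (f : E -> R) (A : 'M[R]_(m, n)) : smooth_on U f ->
  partial_mx c (fun y => f y *: A) x = partial c f x *: A.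
Proof.
move=> sf; apply/matrixP => i j; rewrite !mxE.
have -> : (fun y => (f y *: A) i j) = fun y => f y * A i j.
  by rewrite funeqE => y; rewrite mxE.
rewrite (partialM c Ux sf (smooth_cst oU (A i j))) partial_cst mulr0 addr0.
by [].
Qed.

Lemma partial_mx_sum m n (I : Type) (r : seq I) (F : I -> E -> 'M[R]_(m, n)) :
  (forall i, smooth_mx U (F i)) ->
  partial_mx c (fun y => \sum_(i <- r) F i y) x = \sum_(i <- r) partial_mx c (F i) x.
Proof.
move=> sF; apply/matrixP => i j; rewrite !mxE summxE.
have -> : (fun y => (\sum_(k <- r) F k y) i j) = fun y => \sum_(k <- r) F k y i j.
  by rewrite funeqE => y; rewrite summxE.
rewrite partial_sum; [|exact: Ux|by move=> k; exact: sF].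
by apply: eq_bigr => k _; rewrite mxE.
Qed.

Lemma partial_mxC m n d (A : E -> 'M[R]_(m, n)) : smooth_mx U A ->
  partial_mx c (partial_mx d A) x = partial_mx d (partial_mx c A) x.
Proof.
move=> sA; apply/matrixP => i j; rewrite [LHS]mxE [RHS]mxE.
have dE e : (fun y => partial_mx e A y i j) = partial e (fun y => A y i j).
  by rewrite funeqE => y; rewrite mxE.
transitivity (partial c (partial d (fun y => A y i j)) x).
  by congr (partial c _ x); exact: dE.
rewrite (partialC c d oU Ux (sA i j)).
by congr (partial d _ x); rewrite dE.
Qed.

End Dmx.
End MatrixCalculus.

(** * A smooth orthonormal coframe *)

Section Cholesky.
Variable R : realType.
Local Notation E := 'rV[R]_4.

Definition posdef n (G : 'M[R]_n) : Prop :=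
  G^T = G /\ forall v : 'rV[R]_n, v != 0 -> 0 < (v *m G *m v^T) 0 0.

(** The Schur complement is the restriction of the quadratic form to the
    orthogonal complement of the first basis vector. *)
Lemma posdef_schur n (a : 'M[R]_1) (b : 'rV[R]_n) (D : 'M[R]_n) :
  posdef (block_mx a b b^T D) ->
  0 < a 0 0 /\ posdef (D - (a 0 0)^-1 *: (b^T *m b)).
Proof.
case=> [sG pG].
have [_ _ _ sD] : [/\ a^T = a, b = b, b^T = b^T & D^T = D].
  by move: sG; rewrite tr_block_mx trmxK => /eq_block_mx.
have a0 : 0 < a 0 0.
  have := pG (row_mx 1%:M 0); rewrite mul_row_block tr_row_mx mul_row_col.
  rewrite !(mul1mx, mul0mx, addr0, trmx1, mulmx1, trmx0, mulmx0); apply.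
  apply/eqP => /matrixP /(_ 0 (lshift n 0)) /eqP.
  by rewrite row_mxEl !mxE/= oner_eq0.
split=> //; split.
  by rewrite linearB linearZ/= trmx_mul trmxK sD.
move=> v v0.
(* [row_mx s v] is the vector over [v] orthogonal to the first basis vector. *)
pose s := - (a 0 0)^-1 *: (v *m b^T).
have -> : v *m (D - (a 0 0)^-1 *: (b^T *m b)) *m v^T =
    row_mx s v *m block_mx a b b^T D *m (row_mx s v)^T.
  rewrite mul_row_block tr_row_mx mul_row_col.
  have -> : s *m a + v *m b^T = 0.
    rewrite [a]mx11_scalar mul_mx_scalar /s scalerA.
    by rewrite mulrN mulfV ?gt_eqF// scaleN1r addNr.
  rewrite mul0mx add0r /s mulmxBr -scalemxAr -scalemxAl scaleNr mulmxA.
  by rewrite addrC.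
apply: pG; apply: contraNneq v0 => /(congr1 rsubmx).
by rewrite row_mxKr => ->; apply/eqP/matrixP => i j; rewrite !mxE.
Qed.

(** Gram-Schmidt by induction on the size, in the form
    [theta = block (sqrt a) (b / sqrt a) 0 theta'] with [theta'] a factor of the
    Schur complement.  Only sums, products, inverses and square roots of
    positive functions occur, hence smoothness; the rows of [theta] are an
    oriented orthonormal coframe for [g]. *)
Lemma smooth_cholesky n (U : set E) (g : E -> 'M[R]_n) : open U ->
  smooth_mx U g -> (forall y, U y -> posdef (g y)) ->
  exists theta : E -> 'M[R]_n, smooth_mx U theta /\
    forall y, U y -> (theta y)^T *m theta y = g y /\ 0 < \det (theta y).
Proof.
move=> oU; elim: n g => [|n IH] g sg pg.
  exists (fun=> 1%:M); split; first exact: smooth_mx_cst.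
  by move=> y _; split; [rewrite [RHS]flatmx0 [LHS]flatmx0 | rewrite det1].
pose g' : E -> 'M[R]_(1 + n) := g.
pose a y := ulsubmx (g' y) 0 0; pose b y := ursubmx (g' y).
pose D y := drsubmx (g' y).
have gE y : U y -> g' y = block_mx (a y)%:M (b y) (b y)^T (D y).
  move=> Uy; rewrite -[LHS]submxK /a -mx11_scalar /b /D; congr block_mx.
  have gT : (g' y)^T = g' y by exact: (proj1 (pg y Uy)).
  by rewrite trmx_ursub gT.
have S y : U y -> 0 < a y /\ posdef (D y - (a y)^-1 *: ((b y)^T *m b y)).
  move=> Uy; have : posdef (block_mx (a y)%:M (b y) (b y)^T (D y)).
    by rewrite -gE//; exact: pg.
  by move/posdef_schur; rewrite !mxE/= mulr1n.
have sa : smooth_on U a.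
  by apply: (smooth_eq oU (sg (@lshift 1 n 0) (@lshift 1 n 0))) => y _; rewrite /a !mxE.
have sb : smooth_mx U b.
  by move=> i j; apply: (smooth_eq oU (sg (@lshift 1 n i) (@rshift 1 n j))) => y _; rewrite /b !mxE.
have sD : smooth_mx U D.
  by move=> i j; apply: (smooth_eq oU (sg (@rshift 1 n i) (@rshift 1 n j))) => y _; rewrite /D !mxE.
have saV : smooth_on U (fun y => (a y)^-1).
  by apply: (smoothV oU sa) => y /S[a0 _]; rewrite gt_eqF.
have [|y Uy|th [sth thE]] := IH (fun y => D y - (a y)^-1 *: ((b y)^T *m b y)).
- apply: (smooth_mxB oU sD); apply: (smooth_mxZ oU saV).
  exact: (smooth_mxM oU (smooth_mxT oU sb) sb).
- exact: (proj2 (S y Uy)).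
pose s y := Num.sqrt (a y).
have ss : smooth_on U s by apply: (smooth_sqrt oU sa) => y /S[].
have s0 y : U y -> 0 < s y by move=> /S[a0 _]; rewrite sqrtr_gt0.
have ssV : smooth_on U (fun y => (s y)^-1).
  by apply: (smoothV oU ss) => y /s0 h; rewrite gt_eqF.
pose Th y : 'M[R]_(1 + n) := block_mx (s y)%:M ((s y)^-1 *: b y) 0 (th y).
exists Th; split.
  have sb' := smooth_mxZ oU ssV sb.
  apply: (@smooth_block_mx R U oU 1 n 1 n _ _ _ _ _ sb' _ sth).
    move=> i j; apply: (smooth_eq oU ss) => y _.
    by rewrite mxE !ord1 mulr1n.
  exact: smooth_mx_cst.
move=> y Uy; have [thy dth] := thE y Uy; have sy := s0 y Uy; have [ay _] := S y Uy.
have dE : \det (Th y) = s y * \det (th y).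
  rewrite -[s y in RHS](det_scalar1 (s y)).
  exact: (det_ublock (s y)%:M _ (th y)).
split; last by rewrite [X in 0 < X]dE mulr_gt0.
suff key : (Th y)^T *m Th y = g' y by exact: key.
have ssE : s y * s y = a y by rewrite -expr2 sqr_sqrtr// ltW.
rewrite gE// /Th tr_block_mx mulmx_block trmx0 !(mulmx0, mul0mx, addr0).
rewrite tr_scalar_mx -scalar_mxM ssE mul_scalar_mx scalerA mulfV ?gt_eqF// scale1r.
rewrite linearZ/= -scalemxAl mul_mx_scalar scalerA mulVf ?gt_eqF// scale1r.
congr block_mx; rewrite thy -scalemxAl -scalemxAr scalerA -invfM ssE.
by rewrite addrC subrK.
Qed.

End Cholesky.

(** * The Levi-Civita symbol and duality of 2-forms *)

Section Ordinals.

Lemma ord4_ind (P : 'I_4 -> Prop) :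
  P (@Ordinal 4 0 isT) -> P (@Ordinal 4 1 isT) -> P (@Ordinal 4 2 isT) ->
  P (@Ordinal 4 3 isT) -> forall i, P i.
Proof.
move=> P0 P1 P2 P3 [[|[|[|[|//]]]] lti].
- by rewrite (_ : Ordinal lti = @Ordinal 4 0 isT)//; apply: val_inj.
- by rewrite (_ : Ordinal lti = @Ordinal 4 1 isT)//; apply: val_inj.
- by rewrite (_ : Ordinal lti = @Ordinal 4 2 isT)//; apply: val_inj.
- by rewrite (_ : Ordinal lti = @Ordinal 4 3 isT)//; apply: val_inj.
Qed.

Lemma ord3_ind (P : 'I_3 -> Prop) :
  P (@Ordinal 3 0 isT) -> P (@Ordinal 3 1 isT) -> P (@Ordinal 3 2 isT) ->
  forall i, P i.
Proof.
move=> P0 P1 P2 [[|[|[|//]]] lti].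
- by rewrite (_ : Ordinal lti = @Ordinal 3 0 isT)//; apply: val_inj.
- by rewrite (_ : Ordinal lti = @Ordinal 3 1 isT)//; apply: val_inj.
- by rewrite (_ : Ordinal lti = @Ordinal 3 2 isT)//; apply: val_inj.
Qed.

Lemma sum4 (V : nmodType) (F : 'I_4 -> V) :
  \sum_i F i = F (@Ordinal 4 0 isT) + F (@Ordinal 4 1 isT)
             + F (@Ordinal 4 2 isT) + F (@Ordinal 4 3 isT).
Proof.
rewrite !big_ord_recl big_ord0 addr0 !addrA.
by congr (_ + _ + _ + _); congr F; apply: val_inj.
Qed.

Lemma sum3 (V : nmodType) (F : 'I_3 -> V) :
  \sum_i F i = F (@Ordinal 3 0 isT) + F (@Ordinal 3 1 isT)
             + F (@Ordinal 3 2 isT).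
Proof.
rewrite !big_ord_recl big_ord0 addr0 !addrA.
by congr (_ + _ + _); congr F; apply: val_inj.
Qed.

Lemma prod4 (V : comPzRingType) (F : 'I_4 -> V) :
  \prod_i F i = F (@Ordinal 4 0 isT) * F (@Ordinal 4 1 isT)
             * F (@Ordinal 4 2 isT) * F (@Ordinal 4 3 isT).
Proof.
rewrite !big_ord_recl big_ord0 mulr1 !mulrA.
by congr (_ * _ * _ * _); congr F; apply: val_inj.
Qed.

Lemma ordS3E : [/\ ordS (@Ordinal 3 0 isT) = @Ordinal 3 1 isT,
  ordS (@Ordinal 3 1 isT) = @Ordinal 3 2 isT &
  ordS (@Ordinal 3 2 isT) = @Ordinal 3 0 isT].
Proof. by split; apply: val_inj. Qed.

Lemma lift4E : [/\ lift ord0 (@Ordinal 3 0 isT) = @Ordinal 4 1 isT,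
  lift ord0 (@Ordinal 3 1 isT) = @Ordinal 4 2 isT,
  lift ord0 (@Ordinal 3 2 isT) = @Ordinal 4 3 isT &
  ord0 = @Ordinal 4 0 isT].
Proof. by split; apply: val_inj. Qed.

End Ordinals.

Local Notation o0 := (@Ordinal 4 0 isT).
Local Notation o1 := (@Ordinal 4 1 isT).
Local Notation o2 := (@Ordinal 4 2 isT).
Local Notation o3 := (@Ordinal 4 3 isT).
Local Notation t0 := (@Ordinal 3 0 isT).
Local Notation t1 := (@Ordinal 3 1 isT).
Local Notation t2 := (@Ordinal 3 2 isT).

Section LeviCivita.
Variable R : realType.
Local Notation eps := (@levi_civita R).

(** The matrix defining the symbol carries the Vandermonde matrix of
    0, 1, 2, 3 to that of [a], [b], [c], [d]; the determinant of the former
    is 12.  This formula makes every contraction with the symbol a polynomial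
    identity. *)
Lemma levi_civitaE a b c d :
  eps a b c d = (b%:R - a%:R) * (c%:R - a%:R) * (d%:R - a%:R)
              * (c%:R - b%:R) * (d%:R - b%:R) * (d%:R - c%:R) / 12.
Proof.
pose t := [tuple a; b; c; d].
pose x : 'rV[R]_4 := \row_j j%:R; pose y : 'rV[R]_4 := \row_j (tnth t j)%:R.
have detV (z : 'rV[R]_4) : \det (Vandermonde 4 z) =
    (z 0 o1 - z 0 o0) * (z 0 o2 - z 0 o0) * (z 0 o3 - z 0 o0)
  * (z 0 o2 - z 0 o1) * (z 0 o3 - z 0 o1) * (z 0 o3 - z 0 o2).
  rewrite det_Vandermonde.
  under eq_bigr do rewrite big_mkcond/=.
  rewrite !big_ord_recl !big_ord0/= !(mul1r, mulr1) !mulrA.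
  do ![congr (_ * _)]; congr (z 0 _ - z 0 _); exact: val_inj.
have VT : Vandermonde 4 y =
    Vandermonde 4 x *m (\matrix_(i < 4, j < 4) (tnth t i == j)%:R)^T.
  apply/matrixP => i j; rewrite !mxE (bigD1 (tnth t j))//= !mxE eqxx mulr1.
  rewrite big1 ?addr0// => k kj; rewrite !mxE eq_sym (negbTE kj).
  by rewrite mulr0.
have := congr1 (fun A => \det A) VT; rewrite det_mulmx det_tr !detV !mxE/=.
rewrite -[\det (\matrix_(i, j) _)]/(eps a b c d) /tnth /= => ->.
by field.
Qed.

Lemma sum_levi_civita (M : 'M[R]_4) :
  \sum_p \sum_q \sum_r \sum_s
     eps p q r s * (M o0 p * M o1 q * M o2 r * M o3 s) = \det M.
Proof.
transitivity (\sum_(s : {perm 'I_4}) (-1) ^+ s *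
  (\sum_p \sum_q \sum_r \sum_t
    (s o0 == p)%:R * (s o1 == q)%:R * (s o2 == r)%:R * (s o3 == t)%:R
     * (M o0 p * M o1 q * M o2 r * M o3 t))).
  under [RHS]eq_bigr => s _ do rewrite mulr_sumr.
  rewrite [RHS]exchange_big; apply: eq_bigr => p _.
  under [RHS]eq_bigr => s _ do rewrite mulr_sumr.
  rewrite [RHS]exchange_big; apply: eq_bigr => q _.
  under [RHS]eq_bigr => s _ do rewrite mulr_sumr.
  rewrite [RHS]exchange_big; apply: eq_bigr => r _.
  under [RHS]eq_bigr => s _ do rewrite mulr_sumr.
  rewrite [RHS]exchange_big; apply: eq_bigr => t _.
  rewrite /levi_civita /determinant mulr_suml; apply: eq_bigr => s _.
  rewrite -[LHS]mulrA; congr (_ * _); congr (_ * _).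
  rewrite prod4 !mxE /tnth/=.
  by rewrite [p == _]eq_sym [q == _]eq_sym [r == _]eq_sym [t == _]eq_sym.
rewrite /determinant; apply: eq_bigr => s _; congr (_ * _).
have pick (k : 'I_4) (F : 'I_4 -> R) : \sum_p (k == p)%:R * F p = F k.
  rewrite (bigD1 k)//= eqxx mul1r big1 ?addr0// => p pk.
  by rewrite eq_sym (negbTE pk) mul0r.
rewrite prod4.
transitivity (\sum_p (s o0 == p)%:R * (\sum_q (s o1 == q)%:R *
  (\sum_r (s o2 == r)%:R * (\sum_t (s o3 == t)%:R *
     (M o0 p * M o1 q * M o2 r * M o3 t))))).
  apply: eq_bigr => p _; rewrite mulr_sumr; apply: eq_bigr => q _.
  rewrite !mulr_sumr; apply: eq_bigr => r _.
  rewrite !mulr_sumr; apply: eq_bigr => t _; by rewrite !mulrA.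
by rewrite !pick.
Qed.

(** Both sides are the determinant of the columns [a], [b], [c], [d]
    of [P]. *)
Lemma levi_civita_transform (P : 'M[R]_4) a b c d :
  \sum_p \sum_q \sum_r \sum_s
     eps p q r s * (P p a * P q b * P r c * P s d) = \det P * eps a b c d.
Proof.
pose t := [tuple a; b; c; d].
pose T : 'M[R]_4 := \matrix_(i < 4, j < 4) (tnth t i == j)%:R.
have TP i p : (T *m P^T) i p = P p (tnth t i).
  rewrite !mxE (bigD1 (tnth t i))//= !mxE eqxx mul1r.
  rewrite big1 ?addr0// => k kj; rewrite !mxE eq_sym (negbTE kj).
  by rewrite mul0r.
rewrite mulrC -[\det P]det_tr -det_mulmx -sum_levi_civita.
do 4! [apply: eq_bigr => ? _].
by rewrite !TP /tnth/=.
Qed.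

(** Duality of 2-forms with respect to the coordinate volume; the Hodge star
    is this map after raising indices and scaling by the volume density. *)
Definition dual2 (w : 'M[R]_4) : 'M[R]_4 :=
  \matrix_(c, d) (2^-1 * \sum_a \sum_b w a b * eps a b c d).

Lemma exchange_big2 (F : 'I_4 -> 'I_4 -> 'I_4 -> 'I_4 -> R) :
  \sum_i \sum_j \sum_k \sum_l F i j k l = \sum_k \sum_l \sum_i \sum_j F i j k l.
Proof.
transitivity (\sum_i \sum_k \sum_j \sum_l F i j k l).
  by apply: eq_bigr => i _; rewrite exchange_big.
rewrite exchange_big; apply: eq_bigr => k _ /=.
transitivity (\sum_i \sum_l \sum_j F i j k l).
  by apply: eq_bigr => i _; rewrite exchange_big.
by rewrite exchange_big.
Qed.

(** A change of frame acts on the volume form by its determinant.  It is what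
    reduces the Hodge star of a general metric to the Euclidean one. *)
Lemma dual2_transform (P w : 'M[R]_4) :
  P^T *m dual2 (P *m w *m P^T) *m P = \det P *: dual2 w.
Proof.
apply/matrixP => c d.
pose T r s p q a b := 2^-1 * (w a b * (eps p q r s *
  (P p a * P q b * P r c * P s d))).
transitivity (\sum_s \sum_r \sum_p \sum_q \sum_b \sum_a T r s p q a b).
  rewrite mxE; apply: eq_bigr => s _; rewrite mxE mulr_suml.
  apply: eq_bigr => r _; rewrite !mxE.
  set X := \sum_(a < 4) _.
  rewrite (_ : _ * _ * _ = (2^-1 * P r c * P s d) * X); last by ring.
  rewrite /X mulr_sumr; apply: eq_bigr => p _.
  rewrite mulr_sumr; apply: eq_bigr => q _.
  rewrite !mxE mulr_suml mulr_sumr; apply: eq_bigr => b _.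
  rewrite !mxE !mulr_suml mulr_sumr; apply: eq_bigr => a _.
  by rewrite /T; ring.
under eq_bigr => s _ do under eq_bigr => r _ do rewrite exchange_big2.
rewrite exchange_big2.
under eq_bigr => b _ do under eq_bigr => a _ do rewrite exchange_big2.
rewrite exchange_big !mxE !mulr_sumr; apply: eq_bigr => a _.
rewrite !mulr_sumr; apply: eq_bigr => b _.
rewrite mulrCA [_ * (w a b * _)]mulrCA -levi_civita_transform.
rewrite !mulr_sumr; apply: eq_bigr => p _.
rewrite !mulr_sumr; apply: eq_bigr => q _.
rewrite exchange_big !mulr_sumr; apply: eq_bigr => r _.
rewrite !mulr_sumr; apply: eq_bigr => t _.
by rewrite /T; ring.
Qed.

End LeviCivita.

(** * Self-dual forms of Euclidean 4-space *)

Section StandardSelfDual.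
Variable R : realType.
Implicit Types (p q s : 'rV[R]_3) (w W : 'M[R]_4).
Local Notation r := ((Num.sqrt 2)^-1 : R).

(** The isomorphism from R^3 to Lambda^+ given by the frame [Sigma_i]. *)
Definition frame (theta : 'M[R]_4) p : 'M[R]_4 :=
  \sum_(i < 3) p 0 i *: Sigma_of theta i.

Definition crossv p q : 'rV[R]_3 := \row_i
  (p 0 (ordS i) * q 0 (ordS (ordS i)) - p 0 (ordS (ordS i)) * q 0 (ordS i)).

Definition dotv p q : R := \sum_(i < 3) p 0 i * q 0 i.

Definition entry_ip w W : R := 2^-1 * \sum_a \sum_b w a b * W a b.

Definition sd_form p : 'M[R]_4 := frame 1%:M p.

(** Up to the factor [- (sqrt 2)^-1], the matrix of the self-dual form with
    coordinates [p]: an imaginary quaternion, acting on R^4 by multiplication. *)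
Definition sd_coef p (a b : nat) : R :=
  let x := p 0 t0 in let y := p 0 t1 in let z := p 0 t2 in
  nth 0 (nth [::] [:: [:: 0; x; y; z]; [:: - x; 0; z; - y];
                      [:: - y; - z; 0; x]; [:: - z; y; - x; 0]] a) b.

Lemma sqrt2V2 : r * r = 2^-1.
Proof. by rewrite -expr2 exprVn sqr_sqrtr. Qed.

Lemma sqrt2V : Num.sqrt 2 = 2 * r :> R.
Proof.
have s0 : Num.sqrt 2 != 0 :> R by rewrite gt_eqF// sqrtr_gt0.
by apply: (mulfI s0); rewrite mulrCA mulfV// mulr1 -expr2 sqr_sqrtr.
Qed.

Lemma sd_form_entry p a b : sd_form p a b = - r * sd_coef p a b.
Proof.
have [s0 s1 s2] := ordS3E; have [l0 l1 l2 l3] := lift4E.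
rewrite /sd_form /frame sum3 /Sigma_of /wedge s0 s1 s2 s0 l0 l1 l2 l3.
rewrite !mxE !big_ord1 !mxE /=.
elim/ord4_ind: a => /=; elim/ord4_ind: b => /=; rewrite /sd_coef/=; ring.
Qed.

Lemma frame_sd_form theta p : frame theta p = theta^T *m sd_form p *m theta.
Proof.
have rowE k : row k theta = row k 1%:M *m theta.
  by rewrite -row_mul mul1mx.
have S i : Sigma_of theta i = theta^T *m Sigma_of 1%:M i *m theta.
  rewrite /Sigma_of /wedge !(rowE _) !trmx_mul -scalemxAr -scalemxAl.
  by rewrite !(mulmxDr, mulmxDl, mulmxBr, mulmxBl, mulmxN, mulNmx) !mulmxA.
rewrite /sd_form /frame mulmx_sumr mulmx_suml; apply: eq_bigr => i _.
by rewrite -scalemxAr -scalemxAl S.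
Qed.

Lemma sd_form_skew p : (sd_form p)^T = - sd_form p.
Proof.
apply/matrixP => a b; rewrite mxE [RHS]mxE !sd_form_entry.
by elim/ord4_ind: a; elim/ord4_ind: b; rewrite /sd_coef/=; ring.
Qed.

Lemma dual2_skewE w a b : w^T = - w ->
  dual2 w a b = nth 0 (nth [::] [:: [:: 0; w o2 o3; - w o1 o3; w o1 o2];
     [:: - w o2 o3; 0; w o0 o3; - w o0 o2];
     [:: w o1 o3; - w o0 o3; 0; w o0 o1];
     [:: - w o1 o2; w o0 o2; - w o0 o1; 0]] a) b.
Proof.
move=> wT.
have sk i j : w i j = - w j i.
  by have /matrixP/(_ j i) := wT; rewrite !mxE.
have sk0 i : w i i = 0.
  have := sk i i; lra.
rewrite mxE !sum4 !levi_civitaE [w o1 o0]sk [w o2 o0]sk [w o3 o0]sk.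
rewrite [w o2 o1]sk [w o3 o1]sk [w o3 o2]sk !sk0.
by elim/ord4_ind: a; elim/ord4_ind: b => /=; field.
Qed.

Lemma dual2_sd_form p : dual2 (sd_form p) = sd_form p.
Proof.
apply/matrixP => a b; rewrite dual2_skewE ?sd_form_skew// !sd_form_entry.
by elim/ord4_ind: a; elim/ord4_ind: b; rewrite /sd_coef/=; ring.
Qed.

Lemma dual2_skew w : w^T = - w -> (dual2 w)^T = - dual2 w.
Proof.
move=> wT; apply/matrixP => a b; rewrite mxE [RHS]mxE !dual2_skewE//.
by elim/ord4_ind: a; elim/ord4_ind: b => /=; ring.
Qed.

Lemma dual2K w : w^T = - w -> dual2 (dual2 w) = w.
Proof.
move=> wT.
have sk i j : w i j = - w j i.
  by have /matrixP/(_ j i) := wT; rewrite !mxE.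
have sk0 i : w i i = 0.
  have := sk i i; lra.
apply/matrixP => a b; rewrite dual2_skewE ?dual2_skew// !dual2_skewE//.
elim/ord4_ind: a; elim/ord4_ind: b => /=; rewrite ?sk0 ?opprK//;
  by rewrite [RHS]sk.
Qed.

Definition sd_coord w : 'rV[R]_3 := \row_i entry_ip w (Sigma_of 1%:M i).

Lemma Sigma_of_frame theta i : Sigma_of theta i = frame theta (delta_mx 0 i).
Proof.
rewrite /frame (bigD1 i)//= mxE !eqxx scale1r big1 ?addr0// => j ji.
by rewrite mxE (negbTE ji) andbF scale0r.
Qed.

Lemma skew_entries w : w^T = - w ->
  (forall i j, w i j = - w j i) * (forall i, w i i = 0).
Proof.
move=> wT.
have sk i j : w i j = - w j i.
  by have /matrixP/(_ j i) := wT; rewrite !mxE.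
by split=> // i; have := sk i i; lra.
Qed.

Lemma sd_coord_skew W : W^T = - W ->
  [/\ sd_coord W 0 t0 = - r * (W o0 o1 + W o2 o3),
      sd_coord W 0 t1 = - r * (W o0 o2 - W o1 o3) &
      sd_coord W 0 t2 = - r * (W o0 o3 + W o1 o2)].
Proof.
move=> /skew_entries[sk _].
split; rewrite mxE /entry_ip !sum4 Sigma_of_frame -/(sd_form _) !sd_form_entry /sd_coef !mxE/=.
- by rewrite [W o1 o0]sk [W o3 o2]sk; field.
- by rewrite [W o2 o0]sk [W o3 o1]sk; field.
- by rewrite [W o3 o0]sk [W o2 o1]sk; field.
Qed.

Lemma dual2_fixed_sd w : w^T = - w -> dual2 w = w -> w = sd_form (sd_coord w).
Proof.
move=> wT dw; have [c0 c1 c2] := sd_coord_skew wT.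
have [sk sk0] := skew_entries wT.
have d1 : w o0 o1 = w o2 o3 by rewrite -{1}dw dual2_skewE.
have d2 : w o0 o2 = - w o1 o3 by rewrite -{1}dw dual2_skewE.
have d3 : w o0 o3 = w o1 o2 by rewrite -{1}dw dual2_skewE.
have k x : - r * (- r * (x + x)) = x.
  by rewrite mulrA mulrNN sqrt2V2; field.
have k1 := k (w o2 o3); have k2 := k (w o1 o3); have k3 := k (w o1 o2).
apply/matrixP => a b; rewrite sd_form_entry /sd_coef c0 c1 c2 d1 d2 d3.
elim/ord4_ind: a; elim/ord4_ind: b => /=; rewrite ?sk0 ?[w o1 o0]sk ?[w o2 o0]sk
  ?[w o3 o0]sk ?[w o2 o1]sk ?[w o3 o1]sk ?[w o3 o2]sk ?d1 ?d2 ?d3; lra.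
Qed.

Lemma entry_ip_sd_form p q : entry_ip (sd_form p) (sd_form q) = dotv p q.
Proof.
rewrite /entry_ip /dotv sum3 !sum4 !sd_form_entry /sd_coef/=.
have := sqrt2V2; set rr := r => r2.
transitivity (rr * rr * 2 * (p 0 t0 * q 0 t0 + p 0 t1 * q 0 t1 + p 0 t2 * q 0 t2)).
  by field.
by rewrite r2; field.
Qed.

(** The forms [Sigma_i] are rescaled quaternion units, so the cross product
    is a multiple of the commutator of matrices. *)
Lemma sd_form_commutator p q :
  sd_form p *m sd_form q - sd_form q *m sd_form p = Num.sqrt 2 *: sd_form (crossv p q).
Proof.
have [s0 s1 s2] := ordS3E.
apply/matrixP => a b; rewrite !mxE !sum4 !sd_form_entry.
have := sqrt2V; set rr := r; clearbody rr => ->.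
by elim/ord4_ind: a; elim/ord4_ind: b; rewrite /sd_coef/= ?mxE ?s0 ?s1 ?s2 ?s0; ring.
Qed.

(** so(4) is the sum of two commuting copies of so(3): an antisymmetric [W]
    acts on self-dual forms only through its self-dual part, by a cross
    product. *)
Lemma sd_form_commutator_skew p W : W^T = - W ->
  sd_form p *m W - W *m sd_form p = sd_form (crossv (- Num.sqrt 2 *: sd_coord W) p).
Proof.
move=> WT; have [c0 c1 c2] := sd_coord_skew WT.
have [sk sk0] := skew_entries WT; have [s0 s1 s2] := ordS3E.
have k x : - Num.sqrt 2 * (- r * x) = x.
  by rewrite mulrA mulrNN mulfV ?mul1r// gt_eqF// sqrtr_gt0.
pose Z := - Num.sqrt 2 *: sd_coord W; rewrite -/Z.
have z0 : Z 0 t0 = W o0 o1 + W o2 o3 by rewrite mxE c0 k.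
have z1 : Z 0 t1 = W o0 o2 - W o1 o3 by rewrite mxE c1 k.
have z2 : Z 0 t2 = W o0 o3 + W o1 o2 by rewrite mxE c2 k.
clearbody Z; apply/matrixP => a b; rewrite !mxE !sum4 !sd_form_entry.
by elim/ord4_ind: a; elim/ord4_ind: b; rewrite /sd_coef/= ?mxE ?s0 ?s1 ?s2 ?s0
  ?z0 ?z1 ?z2 ?sk0 ?[W o1 o0]sk ?[W o2 o0]sk ?[W o3 o0]sk
    ?[W o2 o1]sk ?[W o3 o1]sk ?[W o3 o2]sk; ring.
Qed.

(** For imaginary quaternions [x y z - z y x] is twice the real part of
    [x y z], because conjugation reverses the product and changes its sign. *)
Lemma sd_form_triple p q s :
  sd_form p *m sd_form q *m sd_form s - sd_form s *m sd_form q *m sd_form p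
  = (- r * dotv (crossv p q) s)%:M.
Proof.
have [s0 s1 s2] := ordS3E.
have E u v z a b : (sd_form u *m sd_form v *m sd_form z) a b =
    - r * 2^-1 * \sum_(d < 4) \sum_(c < 4) sd_coef u a c * sd_coef v c d * sd_coef z d b.
  rewrite mxE -sqrt2V2 mulr_sumr; apply: eq_bigr => d _.
  rewrite mxE mulr_suml mulr_sumr; apply: eq_bigr => c _.
  rewrite !sd_form_entry; ring.
apply/matrixP => a b; rewrite mxE [X in _ + X]mxE !E !mxE /dotv sum3 !mxE s0 s1 s2 s0.
rewrite !sum4.
by elim/ord4_ind: a; elim/ord4_ind: b; rewrite /sd_coef/=; field.
Qed.

End StandardSelfDual.

(** * Self-dual forms in an oriented orthonormal coframe *)

Section CoframeAlgebra.
Variable R : realType.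
Implicit Types (p q s : 'rV[R]_3) (w W u v P : 'M[R]_4).
Local Notation r := ((Num.sqrt 2)^-1 : R).

Lemma entry_ip_tr w W : entry_ip w W = 2^-1 * \tr (w *m W^T).
Proof.
rewrite /entry_ip /mxtrace; congr (_ * _); apply: eq_bigr => a _.
by rewrite mxE; apply: eq_bigr => b _; rewrite mxE.
Qed.

Lemma entry_ip_congr P w W :
  entry_ip (P^T *m w *m P) W = entry_ip w (P *m W *m P^T).
Proof.
rewrite !entry_ip_tr !trmx_mul trmxK; congr (_ * _).
by rewrite -!mulmxA mxtrace_mulC !mulmxA.
Qed.

Lemma form_ipE (G : 'M[R]_4) w v :
  form_ip G w v = entry_ip w (invmx G *m v *m (invmx G)^T).
Proof.
rewrite /form_ip /entry_ip; congr (_ * _).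
apply: eq_bigr => a _; apply: eq_bigr => b _.
rewrite mxE mulr_sumr exchange_big; apply: eq_bigr => d _ /=.
rewrite !mxE mulr_suml mulr_sumr; apply: eq_bigr => c _; ring.
Qed.

Lemma hodgeE (G : 'M[R]_4) w :
  hodge G w = Num.sqrt (\det G) *: dual2 (invmx G *m w *m (invmx G)^T).
Proof.
apply/matrixP => c d; rewrite !mxE -mulrA mulrCA; congr (_ * (_ * _)).
apply: eq_bigr => a _; apply: eq_bigr => b _.
under eq_bigr do rewrite -mulr_suml; rewrite -mulr_suml; congr (_ * _).
rewrite mxE exchange_big; apply: eq_bigr => f _ /=.
rewrite !mxE mulr_suml; apply: eq_bigr => e _; ring.
Qed.

Section FrameLinear.
Variable theta : 'M[R]_4.

Lemma frameZ k p : frame theta (k *: p) = k *: frame theta p.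
Proof.
by rewrite /frame scaler_sumr; apply: eq_bigr => i _; rewrite mxE scalerA.
Qed.

Lemma frameD p q : frame theta (p + q) = frame theta p + frame theta q.
Proof.
by rewrite /frame -big_split; apply: eq_bigr => i _; rewrite mxE scalerDl.
Qed.

Lemma frameN p : frame theta (- p) = - frame theta p.
Proof. by rewrite -scaleN1r frameZ scaleN1r. Qed.

Lemma frameB p q : frame theta (p - q) = frame theta p - frame theta q.
Proof. by rewrite frameD frameN. Qed.

End FrameLinear.

Section Coframe.
Variables G theta : 'M[R]_4.
Hypotheses (thetaG : theta^T *m theta = G) (theta_pos : 0 < \det theta).

Lemma coframe_unit : theta \in unitmx.
Proof. by rewrite unitmxE unitfE gt_eqF. Qed.
Let theta_unit := coframe_unit.

Lemma coframe_metric_unit : G \in unitmx.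
Proof. by rewrite -thetaG unitmx_mul unitmx_tr theta_unit. Qed.

Lemma coframe_metric_sym : G^T = G.
Proof. by rewrite -thetaG trmx_mul trmxK. Qed.

Lemma coframe_invE : theta *m invmx G *m theta^T = 1%:M.
Proof.
have uT : theta^T \in unitmx by rewrite unitmx_tr.
apply: (can_inj (mulKmx uT)); rewrite !mulmxA thetaG mulmx1.
by rewrite mulmxV ?mul1mx// coframe_metric_unit.
Qed.

Lemma coframe_inv_sym : (invmx G)^T = invmx G.
Proof. by rewrite trmx_inv coframe_metric_sym. Qed.

Lemma oriented_coframe_of : oriented_coframe G theta.
Proof. by split=> //; exact: coframe_invE. Qed.

Lemma sqrt_det_metric : Num.sqrt (\det G) = \det theta.
Proof. by rewrite -thetaG det_mulmx det_tr -expr2 sqrtr_sqr gtr0_norm. Qed.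

Lemma form_ip_congr u v :
  form_ip G (theta^T *m u *m theta) (theta^T *m v *m theta) = entry_ip u v.
Proof.
rewrite form_ipE coframe_inv_sym entry_ip_congr; congr (entry_ip _ _).
rewrite !mulmxA coframe_invE mul1mx -!mulmxA.
by rewrite [theta *m (_ *m _)]mulmxA coframe_invE mulmx1.
Qed.

(** The volume density [Num.sqrt (\det G)] is the determinant that
    [dual2_transform] produces. *)
Lemma hodge_congr u :
  hodge G (theta^T *m u *m theta) = theta^T *m dual2 u *m theta.
Proof.
rewrite hodgeE sqrt_det_metric -dual2_transform coframe_inv_sym.
congr (_ *m dual2 _ *m _).
rewrite !mulmxA coframe_invE mul1mx -!mulmxA.
by rewrite [theta *m (_ *m _)]mulmxA coframe_invE mulmx1.
Qed.

Lemma congrK w :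
  w = theta^T *m ((invmx theta)^T *m w *m invmx theta) *m theta.
Proof.
rewrite !mulmxA -trmx_mul mulVmx// trmx1 mul1mx -mulmxA mulVmx//.
by rewrite mulmx1.
Qed.

Lemma self_dual_frame p : self_dual G (frame theta p).
Proof.
rewrite frame_sd_form; split.
  by rewrite !trmx_mul trmxK sd_form_skew mulNmx mulmxN mulmxA.
by rewrite hodge_congr dual2_sd_form.
Qed.

Definition fcoord w : 'rV[R]_3 := \row_i form_ip G w (Sigma_of theta i).

Lemma form_ip_frame p q : form_ip G (frame theta p) (frame theta q) = dotv p q.
Proof. by rewrite !frame_sd_form form_ip_congr entry_ip_sd_form. Qed.

Lemma fcoord_frame p : fcoord (frame theta p) = p.
Proof.
apply/rowP => i; rewrite mxE Sigma_of_frame form_ip_frame /dotv.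
rewrite (bigD1 i)//= mxE !eqxx mulr1 big1 ?addr0// => j ji.
by rewrite mxE (negbTE ji) andbF mulr0.
Qed.

Lemma frame_inj : injective (frame theta).
Proof. exact: can_inj fcoord_frame. Qed.

Lemma self_dual_coord w : self_dual G w -> exists p, w = frame theta p.
Proof.
case; move: (congrK w); set u := _ *m w *m _ => wE; clearbody u; subst w.
rewrite hodge_congr => uT du.
have uTh : theta^T \in unitmx by rewrite unitmx_tr.
have inj x y : theta^T *m x *m theta = theta^T *m y *m theta -> x = y.
  by move/(can_inj (mulmxK theta_unit))/(can_inj (mulKmx uTh)).
exists (sd_coord u); rewrite frame_sd_form -dual2_fixed_sd//; last exact: inj.
by apply: inj; rewrite mulmxN mulNmx -uT !trmx_mul trmxK mulmxA.
Qed.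

Lemma frame_fcoord w : self_dual G w -> frame theta (fcoord w) = w.
Proof. by move=> /self_dual_coord[p ->]; rewrite fcoord_frame. Qed.

(** The right-hand side does not mention the coframe except through the two
    forms, so it shows that the cross product is independent of the frame,
    orientation included. *)
Lemma frame_commutator p q : frame theta (crossv p q) =
  r *: (frame theta p *m invmx G *m frame theta q
        - frame theta q *m invmx G *m frame theta p).
Proof.
have E x y : frame theta x *m invmx G *m frame theta y =
    theta^T *m (sd_form x *m sd_form y) *m theta.
  rewrite !frame_sd_form !mulmxA -[_ *m theta *m invmx G]mulmxA.
  by rewrite -[_ *m _ *m theta^T]mulmxA coframe_invE mulmx1.
rewrite !E -mulmxBl -mulmxBr sd_form_commutator -scalemxAr -scalemxAl -frame_sd_form.
by rewrite scalerA mulVf ?scale1r// gt_eqF// sqrtr_gt0.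
Qed.

End Coframe.

Lemma oriented_coframeP (G theta : 'M[R]_4) : G \in unitmx ->
  oriented_coframe G theta -> theta^T *m theta = G.
Proof.
move=> uG [tG dt].
have ut : theta \in unitmx by rewrite unitmxE unitfE gt_eqF.
have uT : theta^T \in unitmx by rewrite unitmx_tr.
have E : invmx G *m theta^T = invmx theta.
  by rewrite -[LHS](mulKmx ut) [theta *m _]mulmxA tG mulmx1.
by rewrite -[LHS](mulKVmx uG) [invmx G *m _]mulmxA E mulVmx// mulmx1.
Qed.

Section FrameIndependence.
Variables G theta : 'M[R]_4.
Hypotheses (thetaG : theta^T *m theta = G) (theta_pos : 0 < \det theta).

Let ref := get (oriented_coframe G).

Lemma ref_coframe : ref^T *m ref = G /\ 0 < \det ref.
Proof.
have oref : oriented_coframe G ref.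
  by apply: (getPex (P := oriented_coframe G)); exists theta; exact: oriented_coframe_of.
split; last by case: oref.
by apply: oriented_coframeP oref; exact: coframe_metric_unit thetaG theta_pos.
Qed.

(** [cross] is defined with a frame chosen pointwise; [frame_commutator],
    applied to that frame and to [theta], moves it to [theta]. *)
Lemma cross_frame p q :
  cross G (frame theta p) (frame theta q) = frame theta (crossv p q).
Proof.
have [rG r0] := ref_coframe.
set u := frame theta p; set v := frame theta q.
have su : self_dual G u by exact: self_dual_frame.
have sv : self_dual G v by exact: self_dual_frame.
have -> : cross G u v = frame ref (crossv (fcoord G ref u) (fcoord G ref v)).
  by rewrite /cross /frame; apply: eq_bigr => i _; rewrite !mxE.
rewrite (frame_commutator rG r0) (frame_fcoord rG r0 su) (frame_fcoord rG r0 sv).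
by rewrite (frame_commutator thetaG theta_pos).
Qed.

Variable f : 'M[R]_4 -> 'M[R]_4.
Hypothesis f_endo : endomorphism G f.

Lemma endo_frame p :
  f (frame theta p) = \sum_(i < 3) p 0 i *: f (Sigma_of theta i).
Proof.
have [_ fl] := f_endo.
have sS i : self_dual G (Sigma_of theta i).
  by rewrite Sigma_of_frame; exact: self_dual_frame.
have s0 : self_dual G 0.
  by rewrite -[0](scale0r (frame theta 0)) -frameZ; exact: self_dual_frame.
have f0 : f 0 = 0.
  by have := fl (-1) 0 0 s0 s0; rewrite scaler0 add0r scaleN1r addNr.
have sD k x y : self_dual G x -> self_dual G y -> self_dual G (k *: x + y).
  move=> /(self_dual_coord thetaG theta_pos)[a ->].
  move=> /(self_dual_coord thetaG theta_pos)[b ->].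
  by rewrite -frameZ -frameD; exact: self_dual_frame.
rewrite /frame; suff [] : self_dual G (\sum_(i < 3) p 0 i *: Sigma_of theta i) /\
  f (\sum_(i < 3) p 0 i *: Sigma_of theta i) =
  \sum_(i < 3) p 0 i *: f (Sigma_of theta i) by [].
elim/big_rec2: _ => [|i x y _ [sy <-]]; first by rewrite f0.
by rewrite fl//; split=> //; exact: sD.
Qed.

Definition Bcoord (a b : 'I_4) : 'rV[R]_3 := \row_i f (Sigma_of theta i) a b.

(** Likewise for [B_h]: the change between the chosen frame and that of
    [theta] is an orthogonal matrix [Q], and [Q^T Q = 1] removes it. *)
Lemma Bform_frame a b : Bform G f a b = frame theta (Bcoord a b).
Proof.
have [rG r0] := ref_coframe.
pose Q : 'M[R]_3 := \matrix_(i, j) fcoord G theta (Sigma G i) 0 j.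
have SE i : Sigma G i = frame theta (row i Q).
  rewrite -[LHS](frame_fcoord thetaG theta_pos); last first.
    by rewrite /Sigma Sigma_of_frame; exact: self_dual_frame.
  by congr frame; apply/rowP => j; rewrite [RHS]mxE [RHS]mxE.
have QQ : Q *m Q^T = 1%:M.
  apply/matrixP => i j; rewrite mxE.
  transitivity (form_ip G (Sigma G i) (Sigma G j)).
    rewrite !SE form_ip_frame// /dotv; apply: eq_bigr => k _.
    by rewrite [Q^T _ _]mxE ![row _ _ _ _]mxE.
  rewrite /Sigma !Sigma_of_frame form_ip_frame// /dotv (bigD1 i)//= !mxE !eqxx/=.
  rewrite mul1r big1 ?addr0 // => k ki; rewrite !mxE (negbTE ki).
  by rewrite mul0r.
have {QQ} QQ : Q^T *m Q = 1%:M by apply: mulmx1C.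
rewrite /Bform; under eq_bigr => i _ do rewrite SE endo_frame summxE.
rewrite -[Bcoord a b]mulmx1 -QQ.
transitivity (frame theta (\sum_i ((\sum_k Q i k * Bcoord a b 0 k) *: row i Q))).
  rewrite (big_morph (frame theta) (frameD theta) (id1 := 0)); last first.
    by rewrite -[0](scale0r (0 : 'rV_3)) frameZ scale0r.
  apply: eq_bigr => i _; rewrite frameZ; congr (_ *: _).
  by apply: eq_bigr => k _; rewrite !mxE.
congr frame; apply/rowP => j; rewrite summxE mulmxA mxE.
apply: eq_bigr => i _; rewrite !mxE; congr (_ * _).
by apply: eq_bigr => k _; rewrite !mxE mulrC.
Qed.

End FrameIndependence.
End CoframeAlgebra.

(** * Three-forms and the inverse of ad_h *)

Section Dual2Linear.
Variable R : realType.

Lemma dual2_linear k (w W : 'M[R]_4) :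
  dual2 (k *: w + W) = k *: dual2 w + dual2 W.
Proof.
apply/matrixP => c d.
rewrite [LHS]mxE [RHS]mxE [(k *: dual2 w) c d]mxE ![dual2 _ _ _]mxE mulrCA -mulrDr.
congr (_ * _); rewrite mulr_sumr -big_split; apply: eq_bigr => a _ /=.
rewrite mulr_sumr -big_split; apply: eq_bigr => b _ /=.
by rewrite !mxE; ring.
Qed.

Lemma dual2_0 : dual2 (0 : 'M[R]_4) = 0.
Proof.
have := dual2_linear (-1) 0 (0 : 'M[R]_4).
by rewrite scaler0 add0r scaleN1r addNr.
Qed.

End Dual2Linear.

Section ThreeForms.
Variable R : realType.
Local Notation eps := (@levi_civita R).
Implicit Types (X Y : 'I_4 -> 'I_4 -> 'I_4 -> R) (w : 'M[R]_4).

Definition cyclic_sum (V : nmodType) (X : 'I_4 -> 'I_4 -> 'I_4 -> V) a b c : V :=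
  X a b c + X b c a + X c a b.

(** The vector dual to the 3-form [cyclic_sum X], where [X] is antisymmetric
    in its last two arguments. *)
Definition dual3 X : 'rV[R]_4 :=
  \row_d (2^-1 * \sum_a \sum_b \sum_c X a b c * eps a b c d).

Lemma dual3E X d : (forall a b c, X a b c = - X a c b) ->
  dual3 X 0 d = nth 0 [:: - cyclic_sum X o1 o2 o3; cyclic_sum X o0 o2 o3;
                          - cyclic_sum X o0 o1 o3; cyclic_sum X o0 o1 o2] d.
Proof.
move=> sk; have sk0 a b : X a b b = 0 by have := sk a b b; lra.
rewrite mxE !sum4 !sk0 !levi_civitaE /cyclic_sum.
rewrite ![X _ o1 o0]sk ![X _ o2 o0]sk ![X _ o3 o0]sk.
rewrite ![X _ o2 o1]sk ![X _ o3 o1]sk ![X _ o3 o2]sk.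
by elim/ord4_ind: d => /=; field.
Qed.

(** A 3-form in dimension four is determined by its four components with
    increasing indices, which are those of its dual vector up to sign. *)
Lemma dual3_eq X Y :
  (forall a b c, X a b c = - X a c b) -> (forall a b c, Y a b c = - Y a c b) ->
  dual3 X = dual3 Y <-> forall a b c, cyclic_sum X a b c = cyclic_sum Y a b c.
Proof.
move=> sX sY; split; last first.
  by move=> XY; apply/rowP => d; rewrite !dual3E// !XY.
move=> /rowP XY.
have E0 : cyclic_sum X o1 o2 o3 = cyclic_sum Y o1 o2 o3.
  by have := XY o0; rewrite !dual3E//= => /oppr_inj.
have E1 : cyclic_sum X o0 o2 o3 = cyclic_sum Y o0 o2 o3 by have := XY o1; rewrite !dual3E.
have E2 : cyclic_sum X o0 o1 o3 = cyclic_sum Y o0 o1 o3.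
  by have := XY o2; rewrite !dual3E//= => /oppr_inj.
have E3 : cyclic_sum X o0 o1 o2 = cyclic_sum Y o0 o1 o2 by have := XY o3; rewrite !dual3E.
have sX0 a b : X a b b = 0 by have := sX a b b; lra.
have sY0 a b : Y a b b = 0 by have := sY a b b; lra.
have rot (Z : 'I_4 -> 'I_4 -> 'I_4 -> R) a b c : cyclic_sum Z a b c = cyclic_sum Z b c a.
  by rewrite /cyclic_sum; ring.
have swap (Z : 'I_4 -> 'I_4 -> 'I_4 -> R) a b c :
    (forall a b c, Z a b c = - Z a c b) -> cyclic_sum Z a b c = - cyclic_sum Z b a c.
  move=> sZ; rewrite /cyclic_sum [Z a b c]sZ [Z b c a]sZ [Z c a b]sZ; ring.
have diag (Z : 'I_4 -> 'I_4 -> 'I_4 -> R) a b :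
    (forall a b c, Z a b c = - Z a c b) -> cyclic_sum Z a a b = 0.
  by move=> /(swap Z a a b); lra.
pose P a b c := cyclic_sum X a b c = cyclic_sum Y a b c; suff: forall a b c, P a b c by [].
have Prot a b c : P a b c -> P b c a by rewrite /P (rot X a b c) (rot Y a b c).
have Pswap a b c : P a b c -> P b a c.
  by rewrite /P (swap X a b c)// (swap Y a b c)// => /oppr_inj.
have Pd a b : P a a b by rewrite /P !diag.
have Pd' a b : P a b a by apply: Prot; exact: Pd.
have Pd'' a b : P b a a by apply: Prot; exact: Pd'.
suff le (a b c : 'I_4) : (a < b)%N -> (b < c)%N -> P a b c.
  move=> a b c.
  have [ab|ba|/val_inj ->] := ltngtP a b; last exact: Pd.
    have [bc|cb|/val_inj ->] := ltngtP b c; first exact: le.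
      have [ac|ca|/val_inj ->] := ltngtP a c; last exact: Pd'.
        by apply: Prot; apply: Pswap; exact: le.
      by apply: Prot; exact: le.
    exact: Pd''.
  have [bc|cb|/val_inj ->] := ltngtP b c; last exact: Pd''.
    have [ac|ca|/val_inj ->] := ltngtP a c; last exact: Pd'.
      by apply: Pswap; exact: le.
    by apply/Prot/Prot; exact: le.
  by apply: Pswap; apply: Prot; exact: le.
by rewrite /P; elim/ord4_ind: a; elim/ord4_ind: b; elim/ord4_ind: c.
Qed.

Lemma dual3_wedge (al : 'rV[R]_4) w :
  dual3 (fun a b c => al 0 a * w b c) = al *m dual2 w.
Proof.
apply/rowP => d; rewrite !mxE mulr_sumr; apply: eq_bigr => a _.
rewrite mxE mulrCA; congr (_ * _); rewrite mulr_sumr; apply: eq_bigr => b _.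
rewrite mulr_sumr; apply: eq_bigr => c _; by rewrite !levi_civitaE; field.
Qed.

Lemma dual3B X Y : dual3 (fun a b c => X a b c - Y a b c) = dual3 X - dual3 Y.
Proof.
apply/rowP => d; rewrite !mxE -mulrBr; congr (_ * _).
rewrite -sumrB; apply: eq_bigr => a _; rewrite -sumrB; apply: eq_bigr => b _.
by rewrite -sumrB; apply: eq_bigr => c _; rewrite mulrBl.
Qed.

End ThreeForms.

Lemma det33 (R : comPzRingType) (A : 'M[R]_3) :
  \det A = A t0 t0 * (A t1 t1 * A t2 t2 - A t1 t2 * A t2 t1)
   - A t0 t1 * (A t1 t0 * A t2 t2 - A t1 t2 * A t2 t0)
   + A t0 t2 * (A t1 t0 * A t2 t1 - A t1 t1 * A t2 t0).
Proof.
pose a (i j : nat) := A (inord i) (inord j).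
have aE i j : A i j = a i j by rewrite /a !inord_val.
rewrite (expand_det_row _ t0) sum3 /cofactor.
rewrite !(expand_det_row _ ord0) !big_ord_recl !big_ord0 /cofactor !det_mx11.
rewrite !mxE !aE /= /bump /=; ring.
Qed.

Lemma dotv_crossv_rows (R : realType) (A : 'M[R]_3) l m :
  dotv (crossv (row (ordS m) A) (row l A)) (row (ordS (ordS m)) A)
  = - ((l == m)%:R * \det A).
Proof.
have [s0 s1 s2] := ordS3E.
rewrite det33 /dotv sum3 !mxE.
by elim/ord3_ind: l; elim/ord3_ind: m; rewrite ?s0 ?s1 ?s2 ?s0 ?s1 ?s2 /=; ring.
Qed.

Section AdInverse.
Variable R : realType.
Implicit Types (p q s : 'rV[R]_3) (w : 'M[R]_4).
Local Notation r := ((Num.sqrt 2)^-1 : R).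
Variables G theta : 'M[R]_4.
Hypotheses (thetaG : theta^T *m theta = G) (theta_pos : 0 < \det theta).
Variable f : 'M[R]_4 -> 'M[R]_4.
Hypotheses (f_adj : self_adjoint G f) (f_pos : positive_definite G f).

Let f_endo : endomorphism G f := proj1 f_adj.
Local Notation S := (Sigma_of theta).
Local Notation beta := (fun i => f (Sigma_of theta i)).

Lemma self_dual_Sigma i : self_dual G (S i).
Proof. by rewrite Sigma_of_frame; exact: self_dual_frame. Qed.

(** The matrix of [f] in the frame [Sigma_i], acting on rows. *)
Definition endo_mx : 'M[R]_3 := \matrix_(i, j) fcoord G theta (beta i) 0 j.
Local Notation H := endo_mx.

Lemma f_Sigma_frame i : f (S i) = frame theta (row i H).
Proof.
rewrite -[LHS](frame_fcoord thetaG theta_pos); last first.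
  by apply: (proj1 f_endo); exact: self_dual_Sigma.
by congr frame; apply/rowP => j; rewrite [RHS]mxE [RHS]mxE.
Qed.

Lemma endo_frame_mx p : f (frame theta p) = frame theta (p *m H).
Proof.
rewrite (endo_frame thetaG theta_pos f_endo).
have -> : p *m H = \sum_i p 0 i *: row i H.
  by apply/rowP => j; rewrite mxE summxE; apply: eq_bigr => i _; rewrite !mxE.
rewrite (big_morph (frame theta) (frameD theta) (id1 := 0)); last first.
  by rewrite -[0 : 'rV_3](scale0r (0 : 'rV_3)) frameZ scale0r.
by apply: eq_bigr => i _; rewrite frameZ -f_Sigma_frame.
Qed.

Lemma endo_mx_unit : H \in unitmx.
Proof.
rewrite -row_free_unit; apply: inj_row_free => p pH.
apply/eqP; apply: contraT => p0.
have frame0 : frame theta 0 = 0.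
  by rewrite -[0 : 'rV_3](scale0r (0 : 'rV_3)) frameZ scale0r.
have fp0 : frame theta p != 0.
  by apply: contra p0 => /eqP; rewrite -frame0 => /(frame_inj thetaG theta_pos) ->.
have := f_pos (self_dual_frame thetaG theta_pos p) fp0.
rewrite endo_frame_mx pH form_ip_frame// /dotv big1 ?ltxx// => i _.
by rewrite mxE mul0r.
Qed.

Lemma inverse_frame p : inverse G f (frame theta p) = frame theta (p *m invmx H).
Proof.
set A := [set w | self_dual G w /\ f w = frame theta p].
have : A (get A).
  apply: getPex; exists (frame theta (p *m invmx H)); split.
    exact: self_dual_frame.
  by rewrite endo_frame_mx mulmxKV ?endo_mx_unit.
rewrite -[inverse _ _ _]/(get A) => -[/(self_dual_coord thetaG theta_pos)[q ->]].
rewrite endo_frame_mx => /(frame_inj thetaG theta_pos) <-.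
by rewrite mulmxK ?endo_mx_unit.
Qed.

(** The form [f (Sigma_i)] as an endomorphism of covectors, acting on rows:
    the wedge product of a covector with the form becomes the value of this
    endomorphism, up to duality. *)
Definition raised_endo i : 'M[R]_4 := invmx G *m f (S i).
Local Notation b := raised_endo.

Lemma raised_endo_conj i : b i = invmx theta *m sd_form (row i H) *m theta.
Proof.
have uT := coframe_unit theta_pos.
rewrite /b f_Sigma_frame frame_sd_form !mulmxA; congr (_ *m _ *m _).
by rewrite -[LHS](mulKmx uT) [theta *m _]mulmxA (coframe_invE thetaG theta_pos) mulmx1.
Qed.

(** The three endomorphisms are conjugate to imaginary quaternions with
    coordinates the rows of [H].  The triple product of rows [m + 1], [l],
    [m + 2] vanishes unless [l = m]. *)
Lemma raised_endo_triple l m :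
  b (ordS m) *m b l *m b (ordS (ordS m))
  - b (ordS (ordS m)) *m b l *m b (ordS m) = ((l == m)%:R * (r * \det H))%:M.
Proof.
have uT := coframe_unit theta_pos.
have E i j k : b i *m b j *m b k =
  invmx theta *m (sd_form (row i H) *m sd_form (row j H) *m sd_form (row k H)) *m theta.
  by rewrite !raised_endo_conj !mulmxA !(mulmxK uT).
rewrite !E -mulmxBl -mulmxBr sd_form_triple.
rewrite mul_mx_scalar -scalemxAl mulVmx// scalemx1; congr (_%:M).
by rewrite dotv_crossv_rows mulrNN mulrCA.
Qed.

(** For a self-dual form, dualizing amounts to raising both indices. *)
Lemma dual2_self_dual w : self_dual G w ->
  dual2 w = \det theta *: (invmx G *m w *m invmx G).
Proof.
move=> [wT]; rewrite hodgeE (sqrt_det_metric thetaG theta_pos).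
rewrite (coframe_inv_sym thetaG); set w' := _ *m w *m _ => hw.
have w'T : w'^T = - w'.
  by rewrite !trmx_mul (coframe_inv_sym thetaG) wT mulNmx mulmxN mulmxA.
rewrite -{1}hw.
have -> : dual2 (\det theta *: dual2 w') = \det theta *: dual2 (dual2 w').
  by rewrite -[X in dual2 X = _]addr0 dual2_linear dual2_0 addr0.
by rewrite dual2K.
Qed.

Definition col_coord (n : nat) (al : 'I_n -> 'rV[R]_3) i : 'rV[R]_n :=
  \row_a al a 0 i.

Section Solve.
Variable Om : 'I_4 -> 'I_4 -> 'I_4 -> 'rV[R]_3.
Hypothesis Om_skew : forall a b c, Om a b c = - Om a c b.

Definition dual_rhs i : 'rV[R]_4 :=
  (\det theta)^-1 *: (dual3 (fun a b c => Om a b c 0 i) *m G).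

(** The solution of [ad_h a = Om].  In the coordinates of Lambda^+ the equation
    is a cross product of the unknown with the triple [raised_endo]; by
    [raised_endo_triple], multiplying its component [i] by [b l] and then [b i],
    and summing over [i], isolates the unknown [l]. *)
Definition ad_solution l : 'rV[R]_4 :=
  (r * \det H)^-1 *: \sum_i dual_rhs i *m b l *m b i.

(** Both implications are the identity [raised_endo_triple], summed once on
    each side. *)
Lemma ad_solutionP (u : 'I_3 -> 'rV[R]_4) :
  (forall i, u (ordS i) *m b (ordS (ordS i)) - u (ordS (ordS i)) *m b (ordS i)
             = dual_rhs i) <-> u = ad_solution.
Proof.
have d0 : \det H != 0 by have := endo_mx_unit; rewrite unitmxE unitfE.
have k0 : r * \det H != 0.
  by rewrite mulf_neq0// invr_neq0// gt_eqF// sqrtr_gt0.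
have rearr (x y z x' y' z' : 'rV[R]_4) :
    (x - x') + (y - y') + (z - z') = (y - z') + (z - x') + (x - y').
  by apply/rowP => j; rewrite !mxE; ring.
have [s0 s1 s2] := ordS3E.
move: raised_endo_triple; rewrite /ad_solution; set B := raised_endo => tri; clearbody B.
split=> [uE|->].
  apply/funext => l.
  apply: (scalerI k0); rewrite scalerA mulfV// scale1r.
  transitivity (\sum_m u m *m ((l == m)%:R * (r * \det H))%:M).
    rewrite (bigD1 l)//= eqxx mul1r mul_mx_scalar big1 ?addr0// => m ml.
    by rewrite eq_sym (negbTE ml) mul0r mul_mx_scalar scale0r.
  under eq_bigr => m _ do rewrite -tri mulmxBr !mulmxA.
  under [RHS]eq_bigr => m _ do rewrite -uE !mulmxBl.
  by rewrite !sum3 ?s0 ?s1 ?s2 ?s0 ?s1 ?s2; exact: rearr.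
move=> i; rewrite -!scalemxAl -scalerBr !mulmx_suml -sumrB.
under eq_bigr => m _ do rewrite -!mulmxA -mulmxBr !mulmxA.
transitivity ((r * \det H)^-1 *: \sum_m dual_rhs m *m ((m == i)%:R * (r * \det H))%:M).
  by congr (_ *: _); apply: eq_bigr => m _; rewrite -tri.
rewrite (bigD1 i)//= eqxx mul1r mul_mx_scalar big1 ?addr0 => [|m mi].
  by rewrite scalerA mulVf// scale1r.
by rewrite (negbTE mi) mul0r mul_mx_scalar scale0r.
Qed.

End Solve.
End AdInverse.

Section CrossvLinear.
Variable R : realType.
Implicit Types p q s : 'rV[R]_3.

Lemma crossvDr p q s : crossv p (q + s) = crossv p q + crossv p s.
Proof. by apply/rowP => i; rewrite !mxE; ring. Qed.

Lemma crossvDl p q s : crossv (p + q) s = crossv p s + crossv q s.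
Proof. by apply/rowP => i; rewrite !mxE; ring. Qed.

Lemma crossvNr p q : crossv p (- q) = - crossv p q.
Proof. by apply/rowP => i; rewrite !mxE; ring. Qed.

Lemma crossvNl p q : crossv (- p) q = - crossv p q.
Proof. by apply/rowP => i; rewrite !mxE; ring. Qed.

Lemma crossv0r p : crossv p 0 = 0.
Proof. by apply/rowP => i; rewrite !mxE; ring. Qed.

End CrossvLinear.

Section AdFrame.
Variable R : realType.
Variables G theta : 'M[R]_4.
Hypotheses (thetaG : theta^T *m theta = G) (theta_pos : 0 < \det theta).
Variable f : 'M[R]_4 -> 'M[R]_4.
Hypotheses (f_adj : self_adjoint G f) (f_pos : positive_definite G f).
Local Notation S := (Sigma_of theta).
Local Notation B := (Bcoord theta f).

Let f_endo : endomorphism G f := proj1 f_adj.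

Lemma self_dual_f_Sigma i : self_dual G (f (S i)).
Proof. by apply: (proj1 f_endo); exact: self_dual_Sigma. Qed.

Lemma Bcoord_skew a b : B a b = - B b a.
Proof.
apply/rowP => i; rewrite !mxE; have [bT _] := self_dual_f_Sigma i.
by have /matrixP/(_ b a) := bT; rewrite !mxE.
Qed.

Lemma ad_frame al a b c : ad G f (fun a => frame theta (al a)) a b c =
  frame theta (cyclic_sum (fun a b c => crossv (al a) (B b c)) a b c).
Proof.
rewrite /ad !(Bform_frame thetaG theta_pos f_endo) !cross_frame//.
by rewrite /cyclic_sum !frameD.
Qed.

Variable Om : 'I_4 -> 'I_4 -> 'I_4 -> 'rV[R]_3.
Hypothesis Om_skew : forall a b c, Om a b c = - Om a c b.

Lemma dual3_crossv (al : 'I_4 -> 'rV[R]_3) i :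
  dual3 (fun a b c => crossv (al a) (B b c) 0 i) =
  \det theta *: ((col_coord al (ordS i) *m raised_endo G theta f (ordS (ordS i))
   - col_coord al (ordS (ordS i)) *m raised_endo G theta f (ordS i)) *m invmx G).
Proof.
have -> : (fun a b c => crossv (al a) (B b c) 0 i) = (fun a b c =>
   col_coord al (ordS i) 0 a * f (S (ordS (ordS i))) b c
   - col_coord al (ordS (ordS i)) 0 a * f (S (ordS i)) b c).
  by apply/funext => a; apply/funext => b; apply/funext => c; rewrite !mxE.
rewrite dual3B !dual3_wedge !(dual2_self_dual thetaG theta_pos (self_dual_f_Sigma _)).
by rewrite -!scalemxAr -scalerBr mulmxBl /raised_endo !mulmxA.
Qed.

Lemma ad_solved al : (forall a b c, ad G f (fun a => frame theta (al a)) a b c =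
    frame theta (cyclic_sum Om a b c)) <->
  forall a, al a = \row_l ad_solution G theta f Om l 0 a.
Proof.
have uG := coframe_metric_unit thetaG theta_pos.
have dn0 : \det theta != 0 by rewrite gt_eqF.
pose X i a b c := crossv (al a) (B b c) 0 i.
have sX i a b c : X i a b c = - X i a c b.
  by rewrite /X Bcoord_skew crossvNr mxE.
have sOm i a b c : Om a b c 0 i = - Om a c b 0 i by rewrite Om_skew mxE.
have cycE (Y : 'I_4 -> 'I_4 -> 'I_4 -> 'rV[R]_3) i a b c :
    cyclic_sum Y a b c 0 i = cyclic_sum (fun a b c => Y a b c 0 i) a b c by rewrite !mxE.
have step1 : (forall a b c, ad G f (fun a => frame theta (al a)) a b c =
    frame theta (cyclic_sum Om a b c)) <->
    forall i, dual3 (X i) = dual3 (fun a b c => Om a b c 0 i).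
  split=> [H i|H a b c].
    apply/(dual3_eq (sX i) (sOm i)) => a b c.
    have := H a b c; rewrite ad_frame => /(frame_inj thetaG theta_pos).
    by move=> /(congr1 (fun v : 'rV_3 => v 0 i)); rewrite !cycE.
  rewrite ad_frame; congr frame; apply/rowP => i; rewrite !cycE.
  by move: (H i) => /(dual3_eq (sX i) (sOm i)).
have step2 : (forall i, dual3 (X i) = dual3 (fun a b c => Om a b c 0 i)) <->
    (col_coord al = ad_solution G theta f Om).
  rewrite -(ad_solutionP thetaG theta_pos f_adj f_pos Om).
  split=> H i.
    have := H i; rewrite /X dual3_crossv /dual_rhs => <-.
    by rewrite -scalemxAl mulmxKV// scalerA mulVf// scale1r.
  rewrite /X dual3_crossv H /dual_rhs -!scalemxAl mulmxK// scalerA.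
  by rewrite mulfV// scale1r.
rewrite step1 step2; split=> [H a|H].
  by apply/rowP => l; rewrite mxE -H mxE.
by apply/funext => l; apply/rowP => a; rewrite mxE H mxE.
Qed.

(** [ad_inverse] is chosen by description; [ad_solved] says that the
    description has exactly one solution and gives it. *)
Lemma ad_inverse_frame :
  ad_inverse G f (fun a b c => frame theta (cyclic_sum Om a b c)) =
  fun a => frame theta (\row_l ad_solution G theta f Om l 0 a).
Proof.
set sol := fun a => \row_l ad_solution G theta f Om l 0 a.
set A := [set al | (forall a, self_dual G (al a)) /\
                forall a b c, ad G f al a b c = frame theta (cyclic_sum Om a b c)].
rewrite -[LHS]/(get A).
have : A (get A).
  apply: getPex; exists (fun a => frame theta (sol a)); split.
    by move=> a; exact: self_dual_frame.
  by apply/ad_solved.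
case=> sd_get ad_get.
have E : get A = fun a => frame theta (fcoord G theta (get A a)).
  by apply/funext => a; rewrite frame_fcoord.
rewrite E in ad_get; move/ad_solved : ad_get => solE.
by rewrite E; apply/funext => a; rewrite solE.
Qed.

End AdFrame.

(** * From the wedge identity to self-adjointness *)

Section SelfAdjoint.
Variable R : realType.
Variables G theta : 'M[R]_4.
Hypotheses (thetaG : theta^T *m theta = G) (theta_pos : 0 < \det theta).
Variable f : 'M[R]_4 -> 'M[R]_4.
Hypotheses (f_adj : self_adjoint G f) (f_pos : positive_definite G f).
Variable Fc : 'I_4 -> 'I_4 -> 'rV[R]_3.
Hypothesis Fc_skew : forall a b, Fc a b = - Fc b a.
Local Notation S := (Sigma_of theta).
Local Notation B := (Bcoord theta f).
Hypothesis Fc_wedge :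
  crossv (Fc o0 o1) (B o2 o3) + crossv (Fc o2 o3) (B o0 o1)
  - crossv (Fc o0 o2) (B o1 o3) - crossv (Fc o1 o3) (B o0 o2)
  + crossv (Fc o0 o3) (B o1 o2) + crossv (Fc o1 o2) (B o0 o3) = 0.

Let phi i : 'M[R]_4 := \matrix_(a, b) Fc a b 0 i.
Let psi i : 'M[R]_4 := 2^-1 *: (phi i + hodge G (phi i)).

Let phi_skew i : (phi i)^T = - phi i.
Proof. by apply/matrixP => a b; rewrite !mxE Fc_skew mxE. Qed.

Lemma entry_ip_sym (w W : 'M[R]_4) : entry_ip w W = entry_ip W w.
Proof.
congr (_ * _); apply: eq_bigr => a _; apply: eq_bigr => b _; exact: mulrC.
Qed.

Lemma entry_ip_linear k (w w' W : 'M[R]_4) :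
  entry_ip (k *: w + w') W = k * entry_ip w W + entry_ip w' W.
Proof.
rewrite mulrCA -mulrDr; congr (_ * _).
rewrite mulr_sumr -big_split; apply: eq_bigr => a _ /=.
rewrite mulr_sumr -big_split; apply: eq_bigr => b _ /=.
by rewrite !mxE; ring.
Qed.

Lemma entry_ip_dual2 (w W : 'M[R]_4) : w^T = - w -> W^T = - W ->
  entry_ip w (dual2 W) = w o0 o1 * W o2 o3 - w o0 o2 * W o1 o3
   + w o0 o3 * W o1 o2 + w o1 o2 * W o0 o3 - w o1 o3 * W o0 o2
   + w o2 o3 * W o0 o1.
Proof.
move=> wT WT; have [sk sk0] := skew_entries wT.
rewrite /entry_ip !sum4 !dual2_skewE//=.
rewrite [w o1 o0]sk [w o2 o0]sk [w o3 o0]sk.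
by rewrite [w o2 o1]sk [w o3 o1]sk [w o3 o2]sk !sk0; field.
Qed.

Lemma form_ip_sym (w W : 'M[R]_4) : form_ip G w W = form_ip G W w.
Proof.
rewrite (congrK theta_pos w) (congrK theta_pos W) !(form_ip_congr thetaG theta_pos).
exact: entry_ip_sym.
Qed.

Lemma form_ip_linear k (w w' W : 'M[R]_4) :
  form_ip G (k *: w + w') W = k * form_ip G w W + form_ip G w' W.
Proof. by rewrite !form_ipE entry_ip_linear. Qed.

Lemma hodge_linear k (w W : 'M[R]_4) :
  hodge G (k *: w + W) = k *: hodge G w + hodge G W.
Proof.
rewrite !hodgeE mulmxDr mulmxDl -scalemxAr -scalemxAl dual2_linear scalerDr.
by rewrite !scalerA mulrC.
Qed.

Let psi_self_dual i : self_dual G (psi i).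
Proof.
rewrite /psi; move: (congrK theta_pos (phi i)) (phi_skew i).
set u := _ *m phi i *m _; move: (phi i) => w; clearbody u => -> uT.
have uTh : theta^T \in unitmx by rewrite unitmx_tr coframe_unit.
have uT' : u^T = - u.
  move: uT; rewrite !trmx_mul trmxK -mulNmx -mulmxN mulmxA.
  by move/(can_inj (mulmxK (coframe_unit theta_pos)))/(can_inj (mulKmx uTh)).
rewrite (hodge_congr thetaG theta_pos) -mulmxDl -mulmxDr scalemxAl scalemxAr.
split.
  rewrite !trmx_mul trmxK -mulNmx -mulmxN mulmxA; congr (_ *m _ *m _).
  by rewrite linearZ linearD/= uT' dual2_skew// -opprD scalerN.
rewrite (hodge_congr thetaG theta_pos); congr (_ *m _ *m _).
rewrite -[X in dual2 X]addr0 dual2_linear dual2_0 addr0; congr (_ *: _).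
have := dual2_linear 1 u (dual2 u); rewrite !scale1r dual2K// => ->.
exact: addrC.
Qed.

Lemma entry_ipZr k (w W : 'M[R]_4) : entry_ip w (k *: W) = k * entry_ip w W.
Proof. by rewrite !entry_ip_tr linearZ/= -scalemxAr mxtraceZ mulrCA. Qed.

Let form_ip_phi i w : self_dual G w ->
  form_ip G (phi i) w = (\det theta)^-1 * entry_ip (phi i) (dual2 w).
Proof.
move=> sw; rewrite (dual2_self_dual thetaG theta_pos sw) form_ipE.
rewrite (coframe_inv_sym thetaG) entry_ipZr mulrA mulVf ?mul1r//.
by rewrite gt_eqF.
Qed.

Lemma form_ip_hodge (w W : 'M[R]_4) : w^T = - w -> self_dual G W ->
  form_ip G (hodge G w) W = form_ip G w W.
Proof.
move=> wT /(self_dual_coord thetaG theta_pos)[q ->]; rewrite frame_sd_form.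
move: (congrK theta_pos w) wT.
set u := _ *m w *m _; clearbody u => -> uT.
have uTh : theta^T \in unitmx by rewrite unitmx_tr coframe_unit.
have uT' : u^T = - u.
  move: uT; rewrite !trmx_mul trmxK -mulNmx -mulmxN mulmxA.
  by move/(can_inj (mulmxK (coframe_unit theta_pos)))/(can_inj (mulKmx uTh)).
rewrite (hodge_congr thetaG theta_pos) !(form_ip_congr thetaG theta_pos).
rewrite entry_ip_sym -[in RHS]dual2_sd_form !entry_ip_dual2 ?sd_form_skew//; ring.
Qed.

(** These numbers are [<F_i, h(Sigma_j)>]; only [F_i^+] contributes to them,
    by [form_ip_psi]. *)
Let M i j := form_ip G (phi i) (f (S j)).

Let form_ip_psi i j : form_ip G (psi i) (f (S j)) = M i j.
Proof.
have sb := self_dual_f_Sigma thetaG theta_pos f_adj j.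
rewrite /psi -[X in form_ip G X]addr0 form_ip_linear.
have -> : form_ip G 0 (f (S j)) = 0.
  have := form_ip_linear (-1) 0 0 (f (S j)).
  by rewrite scaler0 add0r mulN1r addNr.
have := form_ip_linear 1 (phi i) (hodge G (phi i)) (f (S j)).
rewrite scale1r mul1r form_ip_hodge// addr0 -/(M i j) => ->.
by lra.
Qed.

(** The components of the hypothesis [Fc_wedge] are the differences
    [M (k + 1) (k + 2) - M (k + 2) (k + 1)], up to the volume density. *)
Let M_sym i j : M i j = M j i.
Proof.
have [s0 s1 s2] := ordS3E.
have ME k l : M k l = (\det theta)^-1 * (
   phi k o0 o1 * f (S l) o2 o3 - phi k o0 o2 * f (S l) o1 o3
   + phi k o0 o3 * f (S l) o1 o2 + phi k o1 o2 * f (S l) o0 o3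
   - phi k o1 o3 * f (S l) o0 o2 + phi k o2 o3 * f (S l) o0 o1).
  have sb := self_dual_f_Sigma thetaG theta_pos f_adj l.
  by rewrite /M form_ip_phi// entry_ip_dual2//; case: sb.
(* [k + 1, k + 2] runs over all pairs of distinct indices, up to order. *)
suff Mk k : M (ordS k) (ordS (ordS k)) = M (ordS (ordS k)) (ordS k).
  have M12 := Mk t0; have M20 := Mk t1; have M01 := Mk t2.
  rewrite ?s0 ?s1 ?s2 ?s0 ?s1 ?s2 in M12 M20 M01.
  by elim/ord3_ind: i; elim/ord3_ind: j.
rewrite !ME; congr (_ * _); apply/eqP; rewrite -subr_eq0; apply/eqP.
have /rowP/(_ k) := Fc_wedge; rewrite !mxE => <-.
ring.
Qed.

Lemma hodge_sum (k : 'I_3 -> R) (w : 'I_3 -> 'M[R]_4) :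
  hodge G (\sum_i k i *: w i) = \sum_i k i *: hodge G (w i).
Proof.
have h0 : hodge G 0 = 0.
  have := hodge_linear (-1) 0 0.
  by rewrite scaler0 add0r scaleN1r addNr.
elim/big_rec2: _ => [|i x y _ <-]; first exact: h0.
by rewrite hodge_linear.
Qed.

Lemma self_dual_part_frame a b :
  self_dual_part G (fun a b => frame theta (Fc a b)) a b
  = frame theta (\row_i psi i a b).
Proof.
apply/matrixP => c d; rewrite mxE [X in _ * X]mxE.
have -> : \matrix_(a', b') frame theta (Fc a' b') c d =
    \sum_i S i c d *: phi i.
  apply/matrixP => a' b'; rewrite mxE !summxE; apply: eq_bigr => i _.
  by rewrite !mxE mulrC.
rewrite hodge_sum /frame !summxE -big_split mulr_sumr; apply: eq_bigr => i _ /=.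
rewrite [(Fc a b 0 i *: S i) c d]mxE [(_ *: S i) c d]mxE.
rewrite [(_ *: hodge G _) a b]mxE [(\row_i0 _) _ _]mxE [psi i a b]mxE.
by rewrite [(phi i + _) a b]mxE [phi i a b]mxE; ring.
Qed.

Lemma endo_of_frame p :
  endo_of G (self_dual_part G (fun a b => frame theta (Fc a b))) (frame theta p)
  = \sum_i p 0 i *: psi i.
Proof.
apply/matrixP => a b; rewrite mxE self_dual_part_frame.
rewrite (form_ip_frame thetaG theta_pos) summxE; apply: eq_bigr => i _.
by rewrite !mxE mulrC.
Qed.

(** With [u = f w] and [v = f z], the pairing of [F^+ (f^-1 u)] with [v] is
    [\sum_(i, j) w_i z_j <F_i^+, f(Sigma_j)>], and the matrix is symmetric. *)
Lemma self_adjoint_wedge :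
  self_adjoint G (endo_of G (self_dual_part G (fun a b => frame theta (Fc a b)))
                  \o inverse G f).
Proof.
pose H := endo_mx G theta f.
have gE p : (endo_of G (self_dual_part G (fun a b => frame theta (Fc a b)))
    \o inverse G f) (frame theta p) = \sum_i (p *m invmx H) 0 i *: psi i.
  by rewrite /= (inverse_frame thetaG theta_pos f_adj f_pos) endo_of_frame.
split; first split.
- move=> u /(self_dual_coord thetaG theta_pos)[p ->]; rewrite gE.
  have -> : \sum_i (p *m invmx H) 0 i *: psi i =
      frame theta (\sum_i (p *m invmx H) 0 i *: fcoord G theta (psi i)).
    rewrite (big_morph (frame theta) (frameD theta) (id1 := 0)); last first.
      by rewrite -[0 : 'rV_3](scale0r (0 : 'rV_3)) frameZ scale0r.
    apply: eq_bigr => i _; rewrite frameZ.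
    by rewrite (frame_fcoord thetaG theta_pos (psi_self_dual i)).
  exact: self_dual_frame.
- move=> k u v /(self_dual_coord thetaG theta_pos)[p ->].
  move=> /(self_dual_coord thetaG theta_pos)[q ->].
  rewrite -frameZ -frameD !gE mulmxDl -scalemxAl scaler_sumr -big_split.
  apply: eq_bigr => i _ /=; rewrite [X in X *: _]mxE scalerDl; congr (_ + _).
  by rewrite [X in X *: _]mxE scalerA.
move=> u v /(self_dual_coord thetaG theta_pos)[p ->].
move=> /(self_dual_coord thetaG theta_pos)[q ->].
rewrite [RHS]form_ip_sym !gE.
have form_sum (c : 'rV[R]_3) w : form_ip G (\sum_i c 0 i *: psi i) w =
    \sum_i c 0 i * form_ip G (psi i) w.
  elim/big_rec2: _ => [|i x y _ <-]; last by rewrite form_ip_linear.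
  have := form_ip_linear (-1) 0 0 w.
  by rewrite scaler0 add0r mulN1r addNr.
have frame_f (c : 'rV[R]_3) :
    frame theta c = \sum_i (c *m invmx H) 0 i *: f (S i).
  rewrite -(endo_frame thetaG theta_pos (proj1 f_adj)).
  rewrite (endo_frame_mx thetaG theta_pos f_adj) mulmxKV//.
  exact: (endo_mx_unit thetaG theta_pos f_adj f_pos).
have form_f i (c : 'rV[R]_3) : form_ip G (psi i) (frame theta c) =
    \sum_j (c *m invmx H) 0 j * M i j.
  rewrite frame_f form_ip_sym; under [RHS]eq_bigr do rewrite -form_ip_psi form_ip_sym.
  elim/big_rec2: _ => [|j x y _ <-]; last by rewrite form_ip_linear.
  have := form_ip_linear (-1) 0 0 (psi i).
  by rewrite scaler0 add0r mulN1r addNr.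
rewrite !form_sum.
under eq_bigr do rewrite form_f mulr_sumr.
under [RHS]eq_bigr do rewrite form_f mulr_sumr.
rewrite exchange_big; apply: eq_bigr => i _; apply: eq_bigr => j _ /=.
by rewrite M_sym mulrCA.
Qed.

End SelfAdjoint.

(** * Connections on the trivial bundle with fibre R^3 *)

Section FrameCalculus.
Variable R : realType.
Local Notation E := 'rV[R]_4.
Implicit Types (U V : set E).

Lemma smooth_mx_sub U V m n (A : E -> 'M[R]_(m, n)) :
  V `<=` U -> smooth_mx U A -> smooth_mx V A.
Proof. by move=> VU sA i j; exact: smooth_on_sub VU (sA i j). Qed.

Lemma smooth_crossv U (p q : E -> 'rV[R]_3) : open U ->
  smooth_mx U p -> smooth_mx U q -> smooth_mx U (fun y => crossv (p y) (q y)).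
Proof.
move=> oU sp sq i j.
apply: (smooth_eq oU (smoothB oU
  (smoothM oU (sp 0 (ordS j)) (sq 0 (ordS (ordS j))))
  (smoothM oU (sp 0 (ordS (ordS j))) (sq 0 (ordS j))))) => y _.
by rewrite mxE.
Qed.

Lemma partial_mx_crossv U c (p q : E -> 'rV[R]_3) x : open U -> U x ->
  smooth_mx U p -> smooth_mx U q ->
  partial_mx c (fun y => crossv (p y) (q y)) x =
  crossv (partial_mx c p x) (q x) + crossv (p x) (partial_mx c q x).
Proof.
move=> oU Ux sp sq; apply/rowP => i.
have pq k l := smoothM oU (sp 0 k) (sq 0 l).
rewrite [LHS]mxE.
have -> : (fun y => crossv (p y) (q y) 0 i) = (fun y =>
   p y 0 (ordS i) * q y 0 (ordS (ordS i)) - p y 0 (ordS (ordS i)) * q y 0 (ordS i)).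
  by apply/funext => y; rewrite mxE.
rewrite (partialB c Ux (pq _ _) (pq _ _)).
rewrite !(partialM c Ux (sp 0 _) (sq 0 _)) !mxE; ring.
Qed.

(** The covariant derivative of the connection [d + A x] on the trivial
    bundle. *)
Definition cov_deriv (A : 'I_4 -> E -> 'rV[R]_3) c (p : E -> 'rV[R]_3) (x : E) :
    'rV[R]_3 :=
  partial_mx c p x + crossv (A c x) (p x).

Definition curvature_coord (A : 'I_4 -> E -> 'rV[R]_3) (a b : 'I_4) (x : E) : 'rV[R]_3 :=
  partial_mx a (A b) x - partial_mx b (A a) x + crossv (A a x) (A b x).

Lemma curvature_coord_skew A a b x : curvature_coord A a b x = - curvature_coord A b a x.
Proof. by apply/rowP => i; rewrite /curvature_coord; move: (partial_mx _ _ _) (partial_mx b _ _) => u v;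
  rewrite !mxE; ring. Qed.

Section Cov.
Variables (U : set E) (A : 'I_4 -> E -> 'rV[R]_3).
Hypotheses (oU : open U) (sA : forall c, smooth_mx U (A c)).

Lemma smooth_cov_deriv c p : smooth_mx U p -> smooth_mx U (cov_deriv A c p).
Proof.
move=> sp; apply: (smooth_mxD oU); first exact: (smooth_partial_mx oU c sp).
exact: (smooth_crossv oU (sA c) sp).
Qed.

Lemma cov_deriv_eq c p q x : U x -> {in U, p =1 q} -> cov_deriv A c p x = cov_deriv A c q x.
Proof. by move=> Ux pq; rewrite /cov_deriv (partial_mx_eq oU c Ux pq) pq// inE. Qed.

Lemma cov_derivD c p q x : U x -> smooth_mx U p -> smooth_mx U q ->
  cov_deriv A c (fun y => p y + q y) x = cov_deriv A c p x + cov_deriv A c q x.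
Proof. by move=> Ux sp sq; rewrite /cov_deriv (partial_mxD c Ux sp sq) crossvDr addrACA. Qed.

Lemma cov_deriv_cst0 c x : U x -> cov_deriv A c (fun=> 0) x = 0.
Proof. by move=> Ux; rewrite /cov_deriv partial_mx_cst crossv0r addr0. Qed.

Lemma cov_derivN c p x : U x -> smooth_mx U p ->
  cov_deriv A c (fun y => - p y) x = - cov_deriv A c p x.
Proof.
move=> Ux sp; apply/eqP; rewrite -subr_eq0 opprK; apply/eqP.
rewrite -(cov_derivD c Ux (smooth_mxN oU sp) sp) -[RHS](cov_deriv_cst0 c Ux).
by apply: (cov_deriv_eq c Ux) => y _; rewrite addNr.
Qed.

(** Second derivatives cancel by [partialC], first derivatives by
    antisymmetry, and the Jacobi identity collects the rest. *)
Lemma cov_deriv_commutator a b p x : U x -> smooth_mx U p ->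
  cov_deriv A a (cov_deriv A b p) x - cov_deriv A b (cov_deriv A a p) x = crossv (curvature_coord A a b x) (p x).
Proof.
move=> Ux sp.
have E2 c d : cov_deriv A c (cov_deriv A d p) x =
    partial_mx c (partial_mx d p) x + crossv (partial_mx c (A d) x) (p x)
    + crossv (A d x) (partial_mx c p x)
    + crossv (A c x) (partial_mx d p x + crossv (A d x) (p x)).
  rewrite {1}/cov_deriv; congr (_ + _).
  rewrite /cov_deriv (partial_mxD c Ux (smooth_partial_mx oU d sp) (smooth_crossv oU (sA d) sp)).
  by rewrite (partial_mx_crossv c oU Ux (sA d) sp) addrA.
rewrite !E2 (partial_mxC oU a Ux b sp) /curvature_coord.
move: (partial_mx b (partial_mx a p) x) (partial_mx a p x) (partial_mx b p x) (partial_mx a (A b) x) (partial_mx b (A a) x).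
move: (A a x) (A b x) (p x) => Aa Ab q ddp da db dAb dAa.
have [s0 s1 s2] := ordS3E.
by apply/rowP => i; rewrite !mxE; elim/ord3_ind: i; rewrite ?s0 ?s1 ?s2 ?s0 ?s1 ?s2; ring.
Qed.

End Cov.

Lemma crossv_inj (p q : 'rV[R]_3) :
  (forall i, crossv p (delta_mx 0 i) = crossv q (delta_mx 0 i)) -> p = q.
Proof.
move=> H; have [s0 s1 s2] := ordS3E.
have K i : p 0 (ordS i) = q 0 (ordS i).
  have /rowP/(_ i) := H (ordS (ordS i)).
  rewrite !mxE !eqxx/=.
  have -> : (ordS i == ordS (ordS i)) = false.
    by elim/ord3_ind: i; rewrite ?s0 ?s1 ?s2 ?s0 ?s1 ?s2.
  by rewrite /= !mulr1 !mulr0 !subr0.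
by apply/rowP; elim/ord3_ind; rewrite -?s0 -?s1 -?s2 K.
Qed.

End FrameCalculus.

(** * The Levi-Civita connection and curvature in a frame of Lambda^+ *)

Section LeviCivitaConnection.
Variable R : realType.
Local Notation E := 'rV[R]_4.
Variables (U : set E) (g theta : E -> 'M[R]_4).
Hypothesis oU : open U.
Hypotheses (sg : smooth_mx U g) (stheta : smooth_mx U theta).
Hypothesis thetaE : forall y, U y ->
  (theta y)^T *m theta y = g y /\ 0 < \det (theta y).

Let thetaG y (Uy : U y) := proj1 (thetaE Uy).
Let theta_pos y (Uy : U y) := proj2 (thetaE Uy).

Definition Gamma c x : 'M[R]_4 := \matrix_(d, a) christoffel g d c a x.

Lemma nablaLCE c s x : nablaLC g c s x =
  partial_mx c s x - (Gamma c x)^T *m s x - s x *m Gamma c x.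
Proof.
apply/matrixP => a b; rewrite !mxE; congr (_ - _ - _); apply: eq_bigr => d _.
  by rewrite !mxE.
by rewrite !mxE mulrC.
Qed.

Lemma nablaLC_eq c s t x : U x -> {in U, s =1 t} -> nablaLC g c s x = nablaLC g c t x.
Proof. by move=> Ux st; rewrite !nablaLCE (partial_mx_eq oU c Ux st) st// inE. Qed.

Lemma smooth_invmx_metric : smooth_mx U (fun y => invmx (g y)).
Proof.
apply: (smooth_invmx oU sg) => y Uy.
exact: coframe_metric_unit (thetaG Uy) (theta_pos Uy).
Qed.

Lemma smooth_Gamma c : smooth_mx U (Gamma c).
Proof.
move=> d a; have sgi := smooth_invmx_metric.
have sp k i j := smooth_on_partial k (sg i j).
apply: (smooth_eq oU (f := fun x => christoffel g d c a x)); last first.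
  by move=> y _; rewrite mxE.
rewrite /christoffel; apply: (smoothM oU (smooth_cst oU _)).
apply: (smooth_sum oU) => l _; apply: (smoothM oU (sgi d l)).
apply: (smoothB oU); last exact: sp.
by apply: (smoothD oU); exact: sp.
Qed.

(** Metric compatibility of the Christoffel symbols: the derivatives of the
    metric in the other two directions cancel between [g Gamma] and its
    transpose. *)
Lemma Gamma_metric c x : U x ->
  partial_mx c g x = (Gamma c x)^T *m g x + g x *m Gamma c x.
Proof.
move=> Ux.
have uG := coframe_metric_unit (thetaG Ux) (theta_pos Ux).
have gsym y : U y -> (g y)^T = g y by move=> Uy; exact: coframe_metric_sym (thetaG Uy).
pose k c b a := partial c (fun y => g y b a) x.
have ksym d i j : k d i j = k d j i.
  apply: (eq_on_partial d oU Ux) => y; rewrite inE => Uy.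
  by rewrite -[in RHS](gsym y Uy) mxE.
have gG a b : (g x *m Gamma c x) a b = 2^-1 * (k c b a + k b c a - k a c b).
  pose K l := k c b l + k b c l - k l c b.
  have -> : Gamma c x = \matrix_(d, e) (2^-1 * \sum_l invmx (g x) d l *
     (k c e l + k e c l - k l c e)).
    by apply/matrixP => d e; rewrite !mxE.
  transitivity (2^-1 * \sum_l (g x *m invmx (g x)) a l * K l).
    rewrite mxE.
    under [in RHS]eq_bigr => l _ do rewrite mxE mulr_suml.
    rewrite exchange_big mulr_sumr; apply: eq_bigr => d _ /=.
    rewrite mxE mulrCA; congr (_ * _); rewrite mulr_sumr.
    by apply: eq_bigr => l _; rewrite mulrA.
  rewrite mulmxV// (bigD1 a)//= mxE eqxx mul1r big1 ?addr0// => l la.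
  by rewrite mxE eq_sym (negbTE la) mul0r.
apply/matrixP => a b; rewrite [LHS]mxE [RHS]mxE.
have -> : ((Gamma c x)^T *m g x) a b = (g x *m Gamma c x) b a.
  by rewrite -[in LHS](gsym x Ux) -trmx_mul mxE.
rewrite !gG -/(k c a b) [k b c a]ksym [k a c b]ksym [k c b a]ksym.
rewrite [k a b c]ksym [k b a c]ksym; lra.
Qed.

(** The connection matrix of Levi-Civita in the coframe, so that the
    covariant derivative of the coframe is [coframe_connection] times it. *)
Definition coframe_connection c x : 'M[R]_4 :=
  (partial_mx c theta x - theta x *m Gamma c x) *m invmx (theta x).

Definition frame_connection c x : 'rV[R]_3 := - Num.sqrt 2 *: sd_coord (coframe_connection c x).

Lemma partial_coframe c x : U x ->
  partial_mx c theta x = theta x *m Gamma c x + coframe_connection c x *m theta x.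
Proof.
move=> Ux; rewrite /coframe_connection mulmxKV ?(coframe_unit (theta_pos Ux))//.
by rewrite addrC subrK.
Qed.

(** Differentiate [theta^T theta = g] and compare with [Gamma_metric]. *)
Lemma coframe_connection_skew c x : U x -> (coframe_connection c x)^T = - coframe_connection c x.
Proof.
move=> Ux; have u := coframe_unit (theta_pos Ux).
have uT : (theta x)^T \in unitmx by rewrite unitmx_tr.
apply/eqP; rewrite -subr_eq0 opprK; apply/eqP.
apply: (can_inj (mulmxK u)); apply: (can_inj (mulKmx uT)).
rewrite mul0mx mulmx0 mulmxDl mulmxDr.
have -> : coframe_connection c x *m theta x = partial_mx c theta x - theta x *m Gamma c x.
  by rewrite /coframe_connection mulmxKV.
have -> : (theta x)^T *m ((coframe_connection c x)^T *m theta x) =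
   (partial_mx c theta x - theta x *m Gamma c x)^T *m theta x.
  by rewrite mulmxA -trmx_mul /coframe_connection mulmxKV.
have := Gamma_metric c Ux.
have -> : partial_mx c g x = partial_mx c (fun y => (theta y)^T *m theta y) x.
  by apply: (partial_mx_eq oU c Ux) => y; rewrite inE => Uy; rewrite thetaG.
rewrite (partial_mxM oU c Ux (smooth_mxT oU stheta) stheta) partial_mxT => dg.
rewrite linearB/= trmx_mul mulmxBl mulmxBr addrACA dg -opprD -(thetaG Ux).
by rewrite !mulmxA subrr.
Qed.

Lemma smooth_frame_connection c : smooth_mx U (frame_connection c).
Proof.
have sW : smooth_mx U (coframe_connection c).
  apply: (smooth_mxM oU).
    apply: (smooth_mxB oU (smooth_partial_mx oU c stheta)).
    exact: (smooth_mxM oU stheta (smooth_Gamma c)).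
  apply: (smooth_invmx oU stheta) => y Uy; exact: coframe_unit (theta_pos Uy).
apply: (smooth_mxZ oU (smooth_cst oU _)) => i j.
apply: (smooth_eq oU (f := fun y => 2^-1 * \sum_a \sum_b coframe_connection c y a b * Sigma_of 1%:M j a b)).
  apply: (smoothM oU (smooth_cst oU _)).
  apply: (smooth_sum oU) => a _; apply: (smooth_sum oU) => b _.
  exact: (smoothM oU (sW a b) (smooth_cst oU _)).
by move=> y _; rewrite mxE.
Qed.

Lemma smooth_frame V p : open V -> V `<=` U -> smooth_mx V p ->
  smooth_mx V (fun y => frame (theta y) (p y)).
Proof.
move=> oV VU sp; have st := smooth_mx_sub VU stheta.
apply: (smooth_mx_eq oV (A := fun y => (theta y)^T *m sd_form (p y) *m theta y)).
  apply: (smooth_mxM oV _ st); apply: (smooth_mxM oV (smooth_mxT oV st)).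
  apply: (smooth_mx_sum oV) => i.
  exact: (smooth_mxZ oV (sp 0 i) (smooth_mx_cst oV _)).
by move=> y _; rewrite frame_sd_form.
Qed.

(** A self-dual form is [theta^T (sd_form p) theta]; the Leibniz rule leaves
    the derivative of [p] and a commutator with the antisymmetric connection
    matrix, which [sd_form_commutator_skew] turns into a cross product.  In
    particular the Levi-Civita derivative preserves Lambda^+. *)
Lemma nablaLC_frame V c p x : open V -> V `<=` U -> V x -> smooth_mx V p ->
  nablaLC g c (fun y => frame (theta y) (p y)) x = frame (theta x) (cov_deriv frame_connection c p x).
Proof.
move=> oV VU Vx sp; have Ux := VU _ Vx; have st := smooth_mx_sub VU stheta.
have ssd : smooth_mx V (fun y => sd_form (p y)).
  apply: (smooth_mx_sum oV) => i.
  exact: (smooth_mxZ oV (sp 0 i) (smooth_mx_cst oV _)).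
have dsd : partial_mx c (fun y => sd_form (p y)) x = sd_form (partial_mx c p x).
  rewrite /sd_form /frame (partial_mx_sum oV c Vx); last first.
    by move=> i; exact: (smooth_mxZ oV (sp 0 i) (smooth_mx_cst oV _)).
  by apply: eq_bigr => i _; rewrite (partial_mxZl oV c Vx _ (sp 0 i)) mxE.
rewrite nablaLCE.
have -> : (fun y => frame (theta y) (p y)) =
    (fun y => (theta y)^T *m sd_form (p y) *m theta y).
  by apply/funext => y; rewrite frame_sd_form.
rewrite (partial_mxM oV c Vx (smooth_mxM oV (smooth_mxT oV st) ssd) st).
rewrite (partial_mxM oV c Vx (smooth_mxT oV st) ssd) partial_mxT dsd (partial_coframe c Ux).
rewrite /cov_deriv frameD [frame _ (crossv _ _)]frame_sd_form.
rewrite -(sd_form_commutator_skew _ (coframe_connection_skew c Ux)) [frame _ (partial_mx c p x)]frame_sd_form.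
rewrite ![frame _ (p x)]frame_sd_form.
have -> : (theta x *m Gamma c x + coframe_connection c x *m theta x)^T =
    (Gamma c x)^T *m (theta x)^T - (theta x)^T *m coframe_connection c x.
  by rewrite linearD/= [X in X + _]trmx_mul [X in _ + X]trmx_mul (coframe_connection_skew c Ux) mulmxN.
move: (coframe_connection c x) (Gamma c x) (sd_form (p x)) (sd_form (partial_mx c p x)) => W Ga s ds.
move: (theta x)^T (theta x) => tT t.
rewrite !(mulmxDl, mulmxDr, mulmxBl, mulmxBr, mulmxN, mulNmx) !mulmxA.
move: (Ga^T *m tT *m s *m t) (tT *m W *m s *m t) (tT *m ds *m t).
move: (tT *m s *m t *m Ga) (tT *m s *m W *m t) => a b d e k.
by apply/matrixP => i j; rewrite !mxE; ring.
Qed.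

Lemma nabla_frame V c al a p x : open V -> V `<=` U -> V x -> smooth_mx V p ->
  al x c = frame (theta x) (a c x) ->
  nabla g al c (fun y => frame (theta y) (p y)) x =
  frame (theta x) (cov_deriv (fun c y => frame_connection c y + a c y) c p x).
Proof.
move=> oV VU Vx sp alE; have Ux := VU _ Vx.
rewrite /nabla (nablaLC_frame c oV VU Vx sp) alE.
rewrite (cross_frame (thetaG Ux) (theta_pos Ux)) -frameD /cov_deriv.
by rewrite crossvDl addrA.
Qed.

Lemma nabla_eq V al c s t x : open V -> V x -> {in V, s =1 t} ->
  nabla g al c s x = nabla g al c t x.
Proof.
move=> oV Vx st; rewrite /nabla !nablaLCE (partial_mx_eq oV c Vx st) st//.
by rewrite inE.
Qed.

Lemma smooth_fcoord V s : open V -> V `<=` U -> smooth_mx V s ->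
  smooth_mx V (fun y => fcoord (g y) (theta y) (s y)).
Proof.
move=> oV VU ss i j; rewrite ord1.
have sgi := smooth_mx_sub VU smooth_invmx_metric.
have sS : smooth_mx V (fun y => Sigma_of (theta y) j).
  apply: (smooth_mx_eq oV (A := fun y => frame (theta y) (delta_mx 0 j))).
    exact: (smooth_frame oV VU (smooth_mx_cst oV _)).
  by move=> y _; rewrite -Sigma_of_frame.
apply: (smooth_eq oV (f := fun y => form_ip (g y) (s y) (Sigma_of (theta y) j)));
  last by move=> y _; rewrite mxE.
apply: (smoothM oV (smooth_cst oV _)).
do 4 (apply: (smooth_sum oV) => ? _).
apply: (smoothM oV _ (sS _ _)); apply: (smoothM oV _ (ss _ _)).
exact: (smoothM oV (sgi _ _) (sgi _ _)).
Qed.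

(** The 2-form [curvature_coord] satisfies the description of the curvature by
    [cov_deriv_commutator].  It is the only one, since the sections of the
    smooth frame separate the forms acting on them by cross product. *)
Lemma curvature_frame al a x : U x ->
  (forall c y, U y -> al y c = frame (theta y) (a c y)) ->
  (forall c, smooth_mx U (a c)) ->
  curvature g al x =
  fun c d => frame (theta x) (curvature_coord (fun c y => frame_connection c y + a c y) c d x).
Proof.
move=> Ux alE sa; apply/funext => c; apply/funext => d.
set A := fun c y => frame_connection c y + a c y.
have sA e : smooth_mx U (A e) := smooth_mxD oU (smooth_frame_connection e) (sa e).
have second V p : open V -> V `<=` U -> V x -> smooth_mx V p ->
    let s := fun y => frame (theta y) (p y) in
    nabla g al c (nabla g al d s) x - nabla g al d (nabla g al c s) x =
    frame (theta x) (crossv (curvature_coord A c d x) (p x)).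
  move=> oV VU Vx sp s.
  have sAV e : smooth_mx V (A e) := smooth_mx_sub VU (sA e).
  have E2 e k : nabla g al e (nabla g al k s) x =
      frame (theta x) (cov_deriv A e (cov_deriv A k p) x).
    rewrite -(nabla_frame oV VU Vx (smooth_cov_deriv oV sAV k sp) (alE e x Ux)).
    apply: (nabla_eq _ _ oV Vx) => y; rewrite inE => Vy.
    exact: (nabla_frame oV VU Vy sp (alE k y (VU _ Vy))).
  by rewrite !E2 -frameB (cov_deriv_commutator oV sAV c d Vx sp).
have tG := thetaG Ux; have tp := theta_pos Ux.
rewrite /curvature; set P := (X in get X).
have : P (get P).
  apply: getPex; exists (frame (theta x) (curvature_coord A c d x)); split.
    exact: self_dual_frame.
  move=> V s oV Vx [ss sds].
  pose V' := V `&` U; have oV' : open V' by exact: openI.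
  have VU' : V' `<=` U by exact: subIsetr.
  have Vx' : V' x by [].
  have ss' : smooth_mx V' s by apply: (smooth_mx_sub _ (ss : smooth_mx V s)) => y [].
  pose p y := fcoord (g y) (theta y) (s y).
  have sp : smooth_mx V' p by exact: smooth_fcoord.
  have sE : {in V', s =1 fun y => frame (theta y) (p y)}.
    move=> y; rewrite inE => -[Vy Uy].
    by rewrite /p (frame_fcoord (thetaG Uy) (theta_pos Uy))//; exact: sds.
  have E3 e k : nabla g al e (nabla g al k s) x =
     nabla g al e (nabla g al k (fun y => frame (theta y) (p y))) x.
    apply: (nabla_eq _ _ oV' Vx') => y; rewrite inE => Vy.
    exact: (nabla_eq _ _ oV' Vy sE).
  rewrite (E3 c d) (E3 d c) (second V' p oV' VU' Vx' sp) (sE x); last by rewrite inE.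
  by rewrite (cross_frame tG tp).
case=> /(self_dual_coord tG tp)[q ->] qE; congr frame; apply: crossv_inj => i.
apply: (frame_inj tG tp); rewrite -(cross_frame tG tp).
(* Test the description on the sections of the frame. *)
pose s y := frame (theta y) (delta_mx 0 i).
have sc : smooth_mx U (fun=> delta_mx 0 i : 'rV[R]_3) by exact: smooth_mx_cst.
rewrite -(second U _ oU (@subset_refl _ U) Ux sc).
have ss : smooth_section g U s.
  split=> [|y Uy]; first exact: (smooth_frame oU (@subset_refl _ U) sc).
  exact: (self_dual_frame (thetaG Uy) (theta_pos Uy)).
by rewrite (qE U s oU Ux ss).
Qed.

End LeviCivitaConnection.

(** * The connection A(h) *)

Section ModifiedConnection.
Variable R : realType.
Local Notation E := 'rV[R]_4.
Variables (U : set E) (g theta : E -> 'M[R]_4).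
Variable h : E -> 'M[R]_4 -> 'M[R]_4.
Hypothesis oU : open U.
Hypotheses (sg : smooth_mx U g) (stheta : smooth_mx U theta).
Hypothesis thetaE : forall y, U y ->
  (theta y)^T *m theta y = g y /\ 0 < \det (theta y).
Hypothesis h_adj : forall y, U y -> self_adjoint (g y) (h y).
Hypothesis h_pos : forall y, U y -> positive_definite (g y) (h y).
Hypothesis h_smooth : forall s, smooth_section g U s ->
  smooth_section g U (fun y => h y (s y)).

Let thetaG y (Uy : U y) := proj1 (thetaE Uy).
Let theta_pos y (Uy : U y) := proj2 (thetaE Uy).
Local Notation S := (fun i y => Sigma_of (theta y) i).
Local Notation frame_connection := (frame_connection g theta).

Definition Bcoord_at a b y : 'rV[R]_3 := Bcoord (theta y) (h y) a b.

Lemma smooth_Sigma i : smooth_mx U (fun y => Sigma_of (theta y) i).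
Proof.
apply: (smooth_mx_eq oU (A := fun y => frame (theta y) (delta_mx 0 i))).
  exact: (smooth_frame stheta oU (@subset_refl _ U) (smooth_mx_cst oU _)).
by move=> y _; rewrite -Sigma_of_frame.
Qed.

Lemma smooth_h_Sigma i : smooth_mx U (fun y => h y (Sigma_of (theta y) i)).
Proof.
have ss : smooth_section g U (fun y => Sigma_of (theta y) i).
  split=> [|y Uy]; first exact: smooth_Sigma.
  exact: (self_dual_Sigma (thetaG Uy) (theta_pos Uy)).
exact: (proj1 (h_smooth ss)).
Qed.

Lemma smooth_Bcoord a b : smooth_mx U (Bcoord_at a b).
Proof.
move=> i j; apply: (smooth_eq oU (smooth_h_Sigma j a b)) => y _.
by rewrite mxE.
Qed.

(** Its cyclic sum is the coordinate vector of [d_Gamma B_h]. *)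
Definition d_LC_coord y a b c : 'rV[R]_3 := cov_deriv frame_connection a (Bcoord_at b c) y.

Lemma Bcoord_at_skew a b y : U y -> Bcoord_at a b y = - Bcoord_at b a y.
Proof. by move=> Uy; exact: (Bcoord_skew (thetaG Uy) (theta_pos Uy) (h_adj Uy)). Qed.

Lemma cov_Bcoord_skew (A : 'I_4 -> E -> 'rV[R]_3) a b c y : U y ->
  cov_deriv A a (Bcoord_at b c) y = - cov_deriv A a (Bcoord_at c b) y.
Proof.
move=> Uy; rewrite -(cov_derivN A oU a Uy (smooth_Bcoord c b)).
by apply: (cov_deriv_eq _ oU a Uy) => z; rewrite inE => Uz; exact: Bcoord_at_skew.
Qed.

Definition A_coord c y : 'rV[R]_3 :=
  - \row_l ad_solution (g y) (theta y) (h y) (d_LC_coord y) l 0 c.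

Lemma d_LC_frame y : U y -> d_LC g (fun y => Bform (g y) (h y)) y =
  fun a b c => frame (theta y) (cyclic_sum (d_LC_coord y) a b c).
Proof.
move=> Uy; apply/funext => a; apply/funext => b; apply/funext => c.
have E k l m : nablaLC g k (fun z => Bform (g z) (h z) l m) y =
    frame (theta y) (d_LC_coord y k l m).
  rewrite /d_LC_coord -(nablaLC_frame oU stheta thetaE k oU (@subset_refl _ U) Uy (smooth_Bcoord l m)).
  apply: (nablaLC_eq g oU k Uy) => z; rewrite inE => Uz.
  exact: (Bform_frame (thetaG Uz) (theta_pos Uz) (proj1 (h_adj Uz))).
by rewrite /d_LC !E /cyclic_sum !frameD.
Qed.

Lemma A_of_frame c y : U y -> A_of g h y c = frame (theta y) (A_coord c y).
Proof.
move=> Uy; rewrite /A_of (d_LC_frame Uy).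
rewrite (ad_inverse_frame (thetaG Uy) (theta_pos Uy) (h_adj Uy) (h_pos Uy)).
  by rewrite /A_coord frameN.
by move=> k l m; exact: cov_Bcoord_skew.
Qed.

Let A c y := frame_connection c y + A_coord c y.

(** The equation [d_A B_h = 0], which is how [A(h)] is made. *)
Lemma cov_A_Bcoord a b c y : U y -> cyclic_sum (fun a b c => cov_deriv A a (Bcoord_at b c) y) a b c = 0.
Proof.
move=> Uy; have tG := thetaG Uy; have tp := theta_pos Uy.
have d_LC_coord_skew k l m : d_LC_coord y k l m = - d_LC_coord y k m l by exact: cov_Bcoord_skew.
(* The converse direction of [ad_solved], applied to the solution itself. *)
pose sol (k : 'I_4) := \row_l ad_solution (g y) (theta y) (h y) (d_LC_coord y) l 0 k.
have [_ /(_ (fun _ => erefl))] :=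
  ad_solved tG tp (h_adj Uy) (h_pos Uy) d_LC_coord_skew sol.
move=> /(_ a b c); rewrite (ad_frame tG tp (h_adj Uy)) => /(frame_inj tG tp) solE.
have covE k l m : cov_deriv A k (Bcoord_at l m) y =
    d_LC_coord y k l m - crossv (sol k) (Bcoord_at l m y).
  by rewrite /cov_deriv /A crossvDl /A_coord crossvNl addrA.
have rearr (d1 d2 d3 x1 x2 x3 : 'rV[R]_3) :
    x1 + x2 + x3 = d1 + d2 + d3 -> d1 - x1 + (d2 - x2) + (d3 - x3) = 0.
  move=> e; transitivity (d1 + d2 + d3 - (x1 + x2 + x3)).
    by apply/rowP => i; rewrite !mxE; ring.
  by rewrite e subrr.
by rewrite /cyclic_sum !covE; exact: rearr solE.
Qed.

(** The closed formula for [ad_h^-1] has the denominators [\det theta] and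
    [\det H], with [H] the matrix of [h]; neither vanishes. *)
Lemma smooth_A_coord c : smooth_mx U (A_coord c).
Proof.
have sb := smooth_h_Sigma.
have sgi := smooth_invmx_metric oU sg thetaE.
have sH : smooth_mx U (fun y => endo_mx (g y) (theta y) (h y)).
  move=> i j; apply: (smooth_eq oU
     (smooth_fcoord oU sg stheta thetaE oU (@subset_refl _ U) (sb i) 0 j)) => y _.
  by rewrite [RHS]mxE.
have sr l : smooth_mx U (fun y => raised_endo (g y) (theta y) (h y) l).
  exact: (smooth_mxM oU sgi (sb l)).
have sO i : smooth_mx U (fun y => dual_rhs (g y) (theta y) (d_LC_coord y) i).
  apply: (smooth_mxZ oU).
    apply: (smoothV oU (smooth_det oU stheta)) => y Uy.
    by rewrite gt_eqF// theta_pos.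
  apply: (smooth_mxM oU _ sg) => i' d.
  apply: (smooth_eq oU (f := fun y => 2^-1 * \sum_k \sum_l \sum_m
      d_LC_coord y k l m 0 i * @levi_civita R k l m d)); last by move=> y _; rewrite mxE.
  apply: (smoothM oU (smooth_cst oU _)).
  apply: (smooth_sum oU) => k _; apply: (smooth_sum oU) => l _.
  apply: (smooth_sum oU) => m _; apply: (smoothM oU _ (smooth_cst oU _)).
  have som e := smooth_frame_connection oU sg stheta thetaE e.
  exact: (smooth_cov_deriv oU som k (smooth_Bcoord l m) 0 i).
have sol l : smooth_mx U (fun y => ad_solution (g y) (theta y) (h y) (d_LC_coord y) l).
  apply: (smooth_mxZ oU).
    apply: (smoothV oU (smoothM oU (smooth_cst oU _) (smooth_det oU sH))) => y Uy.
    apply: mulf_neq0; first by rewrite invr_eq0 gt_eqF// sqrtr_gt0.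
    have := endo_mx_unit (thetaG Uy) (theta_pos Uy) (h_adj Uy) (h_pos Uy).
    by rewrite unitmxE unitfE.
  apply: (smooth_mx_sum oU) => i.
  exact: (smooth_mxM oU (smooth_mxM oU (sO i) (sr l)) (sr i)).
apply: (smooth_mxN oU) => i l.
by apply: (smooth_eq oU (sol l 0 c)) => y _; rewrite [RHS]mxE.
Qed.

(** The only component of [d_A (d_A B_h) = 0].  In the alternating sum of
    the covariant derivatives of [cov_A_Bcoord] the second derivatives pair up
    into six commutators, each of which is a curvature. *)
Lemma curvature_wedge_B x : U x ->
  crossv (curvature_coord A o0 o1 x) (Bcoord_at o2 o3 x) + crossv (curvature_coord A o2 o3 x) (Bcoord_at o0 o1 x)
  - crossv (curvature_coord A o0 o2 x) (Bcoord_at o1 o3 x) - crossv (curvature_coord A o1 o3 x) (Bcoord_at o0 o2 x)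
  + crossv (curvature_coord A o0 o3 x) (Bcoord_at o1 o2 x) + crossv (curvature_coord A o1 o2 x) (Bcoord_at o0 o3 x)
  = 0.
Proof.
move=> Ux.
have sA c : smooth_mx U (A c).
  exact: (smooth_mxD oU (smooth_frame_connection oU sg stheta thetaE c) (smooth_A_coord c)).
have sB := smooth_Bcoord.
pose T d a b c := cov_deriv A d (cov_deriv A a (Bcoord_at b c)) x.
have Tskew d a b c : T d a b c = - T d a c b.
  rewrite /T -(cov_derivN A oU d Ux (smooth_cov_deriv oU sA a (sB c b))).
  by apply: (cov_deriv_eq _ oU d Ux) => y; rewrite inE; exact: cov_Bcoord_skew.
have Tcyc d a b c : T d a b c + T d b c a + T d c a b = 0.
  have s2 k l m := smooth_cov_deriv oU sA k (sB l m).
  rewrite /T -(cov_derivD A d Ux (s2 a b c) (s2 b c a)).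
  rewrite -(cov_derivD A d Ux (smooth_mxD oU (s2 a b c) (s2 b c a)) (s2 c a b)).
  rewrite -[RHS](cov_deriv_cst0 A d Ux); apply: (cov_deriv_eq _ oU d Ux) => y.
  by rewrite inE => Uy; exact: cov_A_Bcoord.
have com a b c d : crossv (curvature_coord A a b x) (Bcoord_at c d x) = T a b c d - T b a c d.
  by rewrite -(cov_deriv_commutator oU sA a b Ux (sB c d)).
rewrite !com; clearbody T.
have c0 := Tcyc o0 o1 o2 o3; have c1 := Tcyc o1 o0 o2 o3.
have c2 := Tcyc o2 o0 o1 o3; have c3 := Tcyc o3 o0 o1 o2.
rewrite [T _ _ o3 o1]Tskew in c0; rewrite [T _ _ o3 o0]Tskew in c1.
rewrite [T _ _ o3 o0]Tskew in c2; rewrite [T _ _ o2 o0]Tskew in c3.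
(* Each line vanishes, being one of [c0], [c1], [c2], [c3]. *)
transitivity ((T o0 o1 o2 o3 - T o0 o2 o1 o3 + T o0 o3 o1 o2)
  - (T o1 o0 o2 o3 - T o1 o2 o0 o3 + T o1 o3 o0 o2)
  + (T o2 o0 o1 o3 - T o2 o1 o0 o3 + T o2 o3 o0 o1)
  - (T o3 o0 o1 o2 - T o3 o1 o0 o2 + T o3 o2 o0 o1)).
  by apply/rowP => i; rewrite !mxE; ring.
by rewrite c0 c1 c2 c3 !subr0 addr0.
Qed.

Lemma Fplus_self_adjoint x : U x ->
  self_adjoint (g x) (Fplus_endo g h x \o inverse (g x) (h x)).
Proof.
move=> Ux; rewrite /Fplus_endo.
rewrite (curvature_frame oU sg stheta thetaE Ux (fun c y Uy => A_of_frame c Uy) smooth_A_coord).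
apply: (self_adjoint_wedge (thetaG Ux) (theta_pos Ux) (h_adj Ux) (h_pos Ux)).
  by move=> a b; exact: curvature_coord_skew.
exact: curvature_wedge_B.
Qed.

End ModifiedConnection.

Theorem lemma2p4 (R : realType) (M : topologicalType)
  (X : oriented_atlas R M)
  (g : chart X -> 'rV[R]_4 -> 'M[R]_4)
  (h : chart X -> 'rV[R]_4 -> 'M[R]_4 -> 'M[R]_4)
  (M_hausdorff : hausdorff_space M)
  (M_compact : compact [set: M])
  (M_connected : connected [set: M])
  (g_metric : riemannian_metric g)
  (h_section : positive_sym_section g h)
  (i : chart X) (x : 'rV[R]_4) (x_cod : cod i x) :
  self_adjoint (g i x) (Fplus_endo (g i) (h i) x \o inverse (g i x) (h i x)).
Proof.
have [g_smooth g_sym g_pos _] := g_metric.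
have [h_adj h_pos h_smooth _] := h_section.
have oU : open (cod i) by exact: cod_open.
have g_posdef y : cod i y -> posdef (g i y).
  by move=> Uy; split; [exact: g_sym | move=> v v0; exact: g_pos].
have [theta [stheta thetaE]] := smooth_cholesky oU (g_smooth i) g_posdef.
apply: (Fplus_self_adjoint oU (g_smooth i) stheta thetaE (h_adj i) (h_pos i) _ x_cod).
move=> s; exact: h_smooth.
Qed.
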